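(* Let $m\ge0$. Then $A_m^{(2)}$ is a free $\mathcal D_2$-module with basis $\{1\}\sqcup\{\delta_{2;m}(x_1^{s(q-1)}) : 2\le s\le q\}$. Moreover, the $\mathcal D_2$-module $\mathcal M=\Big\{\dfrac{f(x_1,x_2)-f(x_1+x_2,x_2)}{x_2^{q^m}} : f\in A_m^{(2)}\Big\}$ does not depend on $m$, and it is the free $\mathcal D_2$-module with basis $$\Big\{\frac{x_1^{s(q-1)+1}+x_2^{s(q-1)+1}-(x_1+x_2)^{s(q-1)+1}}{x_1x_2^q-x_2x_1^q} : 2\le s\le q\Big\}.$$
   Context: $q$ is a power of a prime. Delta operators: for integers $b\ge0$, $c\ge0$, $1\le a\le c+1$, $\delta_{a;b}:\mathbb{F}_q(x_1,\dots,x_c)\to\mathbb{F}_q(x_1,\dots,x_{c+1})$ sends $f$ to $N/L(x_1,\dots,x_a)$, where $N$ is the $a\times a$ determinant whose $t$-th row is $(x_1^{q^{t-1}},\dots,x_a^{q^{t-1}})$ for $t=1,\dots,a-1$ and whose last row is $(x_1^{q^b}f(\hat x_1),\dots,x_a^{q^b}f(\hat x_a))$, with $f(\hat x_i)=f(x_1,\dots,x_{i-1},x_{i+1},\dots,x_{c+1})$, and $L(x_1,\dots,x_a)=\det(x_j^{q^{t-1}})_{1\le t,j\le a}$. (Here $\delta_{2;m}$ is applied with $c=1$.) For $n\ge1$, $A_m^{(n)}$ is the set of $f\in\mathbb{F}_q[x_1,\dots,x_n]$ such that $\delta_{n+1;m}(f)$ (with $c=n$) is a polynomial. Dickson invariants: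 $\prod_{v\in\mathrm{span}_{\mathbb{F}_q}\{x_1,\dots,x_n\}}(X+v)=\sum_{i=0}^n(-1)^{n-i}Q_{n,i}X^{q^i}$ with $Q_{n,n}=1$; $\mathcal D_n=\mathbb{F}_q[Q_{n,0},\dots,Q_{n,n-1}]$ (the $GL_n(\mathbb{F}_q)$-invariants); $A_m^{(n)}$ is a $\mathcal D_n$-module under multiplication. *)

(* Defs.v *)
From HB Require Import structures.
From mathcomp Require Import all_boot all_order all_algebra.
From mathcomp Require Import fraction.
From mathcomp Require Import mpoly.

Set Implicit Arguments.
Unset Strict Implicit.
Unset Printing Implicit Defensive.

Import Order.TTheory GRing.Theory.
Local Open Scope ring_scope.

Definition toF (R : idomainType) (x : R) : {fraction R} := @FracField.tofrac R x.

(* The variable x_{i+1} (0-based index i) of F[x_1,...,x_{n+1}]. *)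
Definition xv (F : finFieldType) (n i : nat) : {mpoly F[n.+1]} := 'X_(inord i).

(* Delta operator delta_{a;b} : F_q(x_1..x_c) -> F_q(x_1..x_{c+1}),
   applied to polynomial inputs f in F_q[x_1..x_c], q = #|F|.
   Row t (0-based, t < a-1) is (x_j^{q^t}); the last row is
   (x_j^{q^b} f(\hat x_j)), where f(\hat x_j) substitutes for the k-th
   variable of f the variable x_{lift j k} of F[x_1..x_{c+1}]
   (i.e. x_j is omitted). *)
Definition Lmoore (F : finFieldType) (c a : nat) : {mpoly F[c.+1]} :=
  \det (\matrix_(t < a, j < a) (xv F c j) ^+ (#|F| ^ t)).

Definition Ndelta (F : finFieldType) (c a b : nat) (f : {mpoly F[c]})
  : {mpoly F[c.+1]} :=
  \det (\matrix_(t < a, j < a)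
          if (t : nat) == a.-1 then
            (xv F c j) ^+ (#|F| ^ b) *
            (f \mPo [tuple 'X_(lift (inord j) k) | k < c])
          else (xv F c j) ^+ (#|F| ^ t)).

Definition delta (F : finFieldType) (c a b : nat) (f : {mpoly F[c]})
  : {fraction {mpoly F[c.+1]}} :=
  toF (@Ndelta F c a b f) / toF (Lmoore F c a).

Definition inA (F : finFieldType) (n m : nat) (f : {mpoly F[n]}) : Prop :=
  exists p : {mpoly F[n.+1]}, @delta F n n.+1 m f = toF p.

(* Dickson invariants: prod_{v in span(x_1..x_n)} (X + v)
     = sum_{i=0}^n (-1)^{n-i} Q_{n,i} X^{q^i}.
   The span is enumerated by coefficient vectors a : 'I_n -> F (the x_j are
   linearly independent, so this enumerates each v exactly once). *)
Definition dicksonProd (F : finFieldType) (n : nat) : {poly {mpoly F[n]}} :=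
  \prod_(a : {ffun 'I_n -> F}) ('X + (\sum_(j < n) a j *: 'X_j)%:P).

Definition Q (F : finFieldType) (n i : nat) : {mpoly F[n]} :=
  (-1) ^+ (n - i) * (dicksonProd F n)`_(#|F| ^ i).

Definition inD (F : finFieldType) (n : nat) (g : {mpoly F[n]}) : Prop :=
  exists P : {mpoly F[n]}, g = P \mPo [tuple Q F n i | i < n].

Definition free_basis (R : comRingType) (D M : R -> Prop) (B : seq R) : Prop :=
  (forall g, M g <->
     exists c : seq R, [/\ size c = size B, (forall i, (i < size c)%N -> D c`_i)
                         & g = \sum_(i < size B) c`_i * B`_i]) /\
  (forall c : seq R, size c = size B -> (forall i, (i < size c)%N -> D c`_i) ->
     \sum_(i < size B) c`_i * B`_i = 0 -> forall i, (i < size c)%N -> c`_i = 0).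

Definition D2K (F : finFieldType) (g : {fraction {mpoly F[2]}}) : Prop :=
  exists d, inD d /\ g = toF d.

Definition A2K (F : finFieldType) (m : nat) (g : {fraction {mpoly F[2]}}) : Prop :=
  exists f : {mpoly F[2]}, inA m f /\ g = toF f.

Definition basisA (F : finFieldType) (m : nat) : seq {fraction {mpoly F[2]}} :=
  1 :: [seq @delta F 1 2 m ((xv F 0 0) ^+ (s * (#|F| - 1))) | s <- iota 2 #|F|.-1].

Definition Mset (F : finFieldType) (m : nat) (g : {fraction {mpoly F[2]}}) : Prop :=
  exists f : {mpoly F[2]}, inA m f /\
    g = (toF f - toF (f \mPo [tuple xv F 1 0 + xv F 1 1; xv F 1 1]))
        / toF ((xv F 1 1) ^+ (#|F| ^ m)).

Definition basisM (F : finFieldType) : seq {fraction {mpoly F[2]}} :=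
  [seq toF ((xv F 1 0) ^+ (s * (#|F| - 1)).+1 + (xv F 1 1) ^+ (s * (#|F| - 1)).+1
             - (xv F 1 0 + xv F 1 1) ^+ (s * (#|F| - 1)).+1)
       / toF (xv F 1 0 * (xv F 1 1) ^+ #|F| - xv F 1 1 * (xv F 1 0) ^+ #|F|)
  | s <- iota 2 #|F|.-1].

(* Main.v *)
(** Write [Lam(a,b) = a b^q - b a^q], [[s] = s(q-1)+1] and
    [P(X) = X^(q^2) - Q1 X^q + Q0 X], whose roots are the points of
    [V = span(x1,x2)]. The Moore determinant of [x1,x2,x3] is
    [Lam(x1,x2) P(x3)], so [f] lies in [A_m] only if the numerator of
    [delta_{3;m} f] vanishes for all [x3] in [V]. This makes [f] symmetric and a
    polynomial in [x1^(q-1), x2^(q-1)], hence on [V] both [Lam(x,y) f(x,y)] and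
    [x^(q^m)] reduce modulo [P] to combinations of the [x^[s] y^[t]], resp. of
    [x^q] and [x], with [s,t <= q] and coefficients in [D_2]. As polynomials of
    degree less than [q^2] are determined by their values on [V], comparing
    coefficients gives [Q0^k f] as a [D_2]-combination of
    [u_s = (x2^(q^m) x1^[s] - x1^(q^m) x2^[s]) / Lam(x1,x2)], [s <= q], where
    [u_0] and [u_1] are in [D_2].

    The transvection [x1 -> x1 + x2] fixes [D_2] and [Lam], and it sends [u_s] to
    [u_s - x2^(q^m) h_s] with [h_s = (x1^[s] + x2^[s] - (x1+x2)^[s]) / Lam]. The
    power of [Q0] is then removed, and freeness is obtained, because the [h_s],
    [2 <= s <= q], are independent modulo [Q0 = Lam^(q-1)]: modulo [x2^q] one has
    [(x1+x2)^[s] = x1^(q(s-1)) (x1+x2)^(q-s+1)], and the exponents [q-s+1] are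
    distinct and positive. *)

Require Import Defs.
From HB Require Import structures.
From mathcomp Require Import all_boot all_order all_algebra.
From mathcomp Require Import fraction finfield.
From mathcomp Require Import mpoly.
From mathcomp Require Import ring zify.

Set Implicit Arguments.
Unset Strict Implicit.
Unset Printing Implicit Defensive.

Import GRing.Theory.
Local Open Scope ring_scope.

(** * General facts on substitution, small determinants, fractions and binomials *)

Lemma comp_mpoly_comp (R : comNzRingType) n k l (p : {mpoly R[n]})
    (t : n.-tuple {mpoly R[k]}) (s : k.-tuple {mpoly R[l]}) :
  (p \mPo t) \mPo s = p \mPo [tuple of map (comp_mpoly s) t].
Proof.
rewrite !(comp_mpolyE p) rmorph_sum /=; apply: eq_bigr => m _.
rewrite comp_mpolyZ rmorph_prod /=; congr (_ *: _); apply: eq_bigr => i _.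
by rewrite rmorphXn /= tnth_map.
Qed.

Lemma comp_mpolyM (R : comNzRingType) n k (t : n.-tuple {mpoly R[k]})
  (f g : {mpoly R[n]}) : (f * g) \mPo t = (f \mPo t) * (g \mPo t).
Proof. exact: rmorphM. Qed.

Lemma comp_mpolyXn (R : comNzRingType) n k (t : n.-tuple {mpoly R[k]})
  (f : {mpoly R[n]}) e : (f ^+ e) \mPo t = (f \mPo t) ^+ e.
Proof. exact: rmorphXn. Qed.

Lemma det22 (S : comNzRingType) (G : nat -> nat -> S) :
  \det (\matrix_(t < 2, j < 2) G t j) = G 0 0 * G 1 1 - G 0 1 * G 1 0.
Proof.
rewrite (expand_det_row _ ord0) !big_ord_recl big_ord0 /cofactor.
by rewrite !det_mx11 !mxE /=; ring.
Qed.

Lemma det33 (S : comNzRingType) (G : nat -> nat -> S) :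
  \det (\matrix_(t < 3, j < 3) G t j) =
  G 2 0 * (G 0 1 * G 1 2 - G 0 2 * G 1 1) - G 2 1 * (G 0 0 * G 1 2 - G 0 2 * G 1 0)
  + G 2 2 * (G 0 0 * G 1 1 - G 0 1 * G 1 0).
Proof.
rewrite (expand_det_row _ ord0) !big_ord_recl big_ord0 /cofactor.
rewrite !(expand_det_row _ ord0) !big_ord_recl !big_ord0 /cofactor.
by rewrite !det_mx11 !mxE /=; ring.
Qed.

Lemma toF_inj (R : idomainType) : injective (@toF R).
Proof. by move=> x y /eqP; rewrite /toF tofrac_eq => /eqP. Qed.

Lemma toF_div_eq (R : idomainType) (u v s x l : R) :
  toF x != 0 -> toF l != 0 -> l * (u - v) = x * s ->
  (toF u - toF v) / toF x = toF s / toF l.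
Proof.
move=> x0 l0 E; apply/eqP; rewrite eqr_div //; apply/eqP.
by rewrite /toF -tofracB [LHS]mulrC [RHS]mulrC -!tofracM E.
Qed.

Lemma expr_add_mod (S : comNzRingType) (a b : S) n : exists w, (a + b) ^+ n = a ^+ n + b * w.
Proof.
exists (\sum_(i < n) (a + b) ^+ (n.-1 - i) * a ^+ i).
have := subrXX (a + b) a n; rewrite {2}[a + b]addrC addrK => <-.
by rewrite [RHS]addrC subrK.
Qed.

(** The left side has degree at most [n] in ['X], so divisibility by ['X^(n.+1)] makes it zero. The
    shift ['X - t] then turns the binomials into the distinct positive powers ['X^(n - i)], and the
    [a i] are read off as coefficients. *)
Lemma binomial_diff_free (T : idomainType) n (t : T) (a : 'I_n -> T) W :
  \sum_(i < n) (a i)%:P * (t%:P ^+ (n - i) - (t%:P + 'X) ^+ (n - i)) = 'X^(n.+1) * W ->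
  forall i, a i = 0.
Proof.
set G := \sum_(i < n) _ => E.
have sG : (size G <= n.+1)%N.
  apply: leq_trans (size_sum _ _ _) _; apply/bigmax_leqP => i _.
  rewrite mul_polyC; apply: leq_trans (size_scale_leq _ _) _.
  apply: leq_trans (size_polyD _ _) _; rewrite size_polyN geq_max -rmorphXn /=.
  rewrite (leq_trans (size_polyC_leq1 _)) //= addrC.
  rewrite (leq_trans (size_poly_exp_leq _ _)) // size_XaddC mul1n.
  by rewrite ltnS leq_subr.
have G0 : G = 0.
  apply/polyP => j; rewrite coef0; case: (ltnP j n.+1) => ltj.
    by rewrite E coefXnM ltj.
  by rewrite nth_default // (leq_trans sG).
have : G \Po ('X - t%:P) = 0 by rewrite G0 comp_poly0.
rewrite /G raddf_sum /= => E2 i.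
have := congr1 (fun p : {poly _} => p`_(n - i)) E2; rewrite coef0 coef_sum.
have ni (k : 'I_n) : (n - k == 0)%N = false by apply/eqP; have := ltn_ord k; lia.
have C k : ((a k)%:P * (t%:P ^+ (n - k) - (t%:P + 'X) ^+ (n - k)) \Po ('X - t%:P))`_(n - i)
    = - (a k * (k == i)%:R).
  rewrite rmorphM rmorphB !rmorphXn rmorphD /= !comp_polyC comp_polyX.
  rewrite [t%:P + ('X - t%:P)]addrC subrK coefCM coefB -rmorphXn /= coefC ni sub0r coefXn mulrN.
  congr (- (_ * _%:R)).
  congr nat_of_bool; apply/eqP/eqP => [e|->//]; apply: val_inj => /=.
  by have := ltn_ord k; have := ltn_ord i; lia.
rewrite (eq_bigr _ (fun k _ => C k)) (bigD1 i) //= eqxx mulr1 big1 ?addr0.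
  by move/eqP; rewrite oppr_eq0 => /eqP.
by move=> k /negbTE ->; rewrite mulr0 oppr0.
Qed.

Section Dickson.

Variable F : finFieldType.

Notation q := #|F|.

(** * Frobenius powers and substitutions *)

Lemma pnat_pchar_mpoly n m : [pchar {mpoly F[n]}].-nat (q ^ m)%N.
Proof.
have [p p_pr pF] := finPcharP F.
have pS : p \in [pchar {mpoly F[n]}] by rewrite pchar_lalg.
rewrite (eq_pnat _ (pcharf_eq pS)) (card_pprimeChar pF) -expnM.
by rewrite pnatX pnat_id.
Qed.

Lemma exprD_card n m (x y : {mpoly F[n]}) :
  (x + y) ^+ (q ^ m) = x ^+ (q ^ m) + y ^+ (q ^ m).
Proof. by apply: exprDn_pchar; apply: pnat_pchar_mpoly. Qed.

Lemma exprN_card n m (x : {mpoly F[n]}) : (- x) ^+ (q ^ m) = - x ^+ (q ^ m).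
Proof.
apply/eqP; rewrite -addr_eq0 -exprD_card addNr expr0n expn_eq0.
by rewrite -leqn0 leqNgt (ltnW (finNzRing_gt1 F)).
Qed.

Lemma mpolyC_card n m (a : F) : (a%:MP_[n]) ^+ (q ^ m) = a%:MP_[n].
Proof.
rewrite -rmorphXn /=; congr (_%:MP).
by elim: m => [|m IH]; rewrite ?expr1 // expnSr exprM IH expf_card.
Qed.

Lemma lincomb_card n m a b (x y : {mpoly F[n]}) :
  (a%:MP * x + b%:MP * y) ^+ (q ^ m) =
  a%:MP * x ^+ (q ^ m) + b%:MP * y ^+ (q ^ m).
Proof. by rewrite exprD_card !exprMn !mpolyC_card. Qed.

Lemma xv_comp n i k (t : n.+1.-tuple {mpoly F[k]}) :
  (i < n.+1)%N -> xv F n i \mPo t = t`_i.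
Proof. by move=> ltin; rewrite comp_mpolyXU inordK. Qed.

Definition subst2 n (f : {mpoly F[2]}) (a b : {mpoly F[n]}) : {mpoly F[n]} :=
  f \mPo [tuple a; b].

Notation x1 := (xv F 1 0).
Notation x2 := (xv F 1 1).
Notation y1 := (xv F 2 0).
Notation y2 := (xv F 2 1).
Notation y3 := (xv F 2 2).

Lemma subst2_x1 n (a b : {mpoly F[n]}) : subst2 x1 a b = a.
Proof. exact: xv_comp. Qed.

Lemma subst2_x2 n (a b : {mpoly F[n]}) : subst2 x2 a b = b.
Proof. exact: xv_comp. Qed.

Lemma subst2D n (f g : {mpoly F[2]}) (a b : {mpoly F[n]}) :
  subst2 (f + g) a b = subst2 f a b + subst2 g a b.
Proof. exact: rmorphD. Qed.
Lemma subst2B n (f g : {mpoly F[2]}) (a b : {mpoly F[n]}) :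
  subst2 (f - g) a b = subst2 f a b - subst2 g a b.
Proof. exact: rmorphB. Qed.
Lemma subst2N n (f : {mpoly F[2]}) (a b : {mpoly F[n]}) :
  subst2 (- f) a b = - subst2 f a b.
Proof. exact: rmorphN. Qed.
Lemma subst2M n (f g : {mpoly F[2]}) (a b : {mpoly F[n]}) :
  subst2 (f * g) a b = subst2 f a b * subst2 g a b.
Proof. exact: (rmorphM (comp_mpoly [tuple a; b])). Qed.
Lemma subst2X n (f : {mpoly F[2]}) k (a b : {mpoly F[n]}) :
  subst2 (f ^+ k) a b = subst2 f a b ^+ k.
Proof. exact: (rmorphXn (comp_mpoly [tuple a; b])). Qed.
Lemma subst2C n c (a b : {mpoly F[n]}) : subst2 c%:MP a b = c%:MP.
Proof. exact: comp_mpolyC. Qed.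
Lemma subst2_0 n (a b : {mpoly F[n]}) : subst2 0 a b = 0.
Proof. exact: raddf0. Qed.
Lemma subst2_1 n (a b : {mpoly F[n]}) : subst2 1 a b = 1.
Proof. exact: comp_mpoly1. Qed.
Lemma subst2_sum n (I : Type) (r : seq I) (f : I -> {mpoly F[2]}) (a b : {mpoly F[n]}) :
  subst2 (\sum_(i <- r) f i) a b = \sum_(i <- r) subst2 (f i) a b.
Proof. exact: raddf_sum. Qed.

Lemma subst2_id f : subst2 f x1 x2 = f.
Proof.
rewrite -[RHS]comp_mpoly_id /subst2; congr comp_mpoly.
apply: eq_from_tnth => i; rewrite tnth_map tnth_ord_tuple !(tnth_nth 0) /=.
by case: i => [[|[|//]]] lti /=; congr 'X_(_); apply: val_inj; rewrite /= inordK.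
Qed.

Lemma subst2_subst2 n k f (a b : {mpoly F[k]}) (t : k.-tuple {mpoly F[n]}) :
  (subst2 f a b) \mPo t = subst2 f (a \mPo t) (b \mPo t).
Proof.
rewrite /subst2 comp_mpoly_comp; congr comp_mpoly.
by apply: val_inj.
Qed.

Ltac subst2E := rewrite ?(subst2B, subst2N, subst2D, subst2M, subst2X, subst2C, subst2_0,
  subst2_1, subst2_x1, subst2_x2).

(** * The form [Lam] and polynomials vanishing on the plane [V] *)

Definition Lam (S : comNzRingType) (a b : S) := a * b ^+ q - b * a ^+ q.

Lemma q_gt1 : (1 < q)%N. Proof. exact: finNzRing_gt1. Qed.

Lemma subst2_Lam n f g (a b : {mpoly F[n]}) :
  subst2 (Lam f g) a b = Lam (subst2 f a b) (subst2 g a b).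
Proof. by rewrite /Lam !(subst2B, subst2M, subst2X). Qed.

Lemma Lam_lincombr n (x y z : {mpoly F[n]}) a b :
  Lam z (a%:MP * x + b%:MP * y) = a%:MP * Lam z x + b%:MP * Lam z y.
Proof. by have := lincomb_card 1 a b x y; rewrite expn1 /Lam => ->; ring. Qed.

Lemma LamDl n (x y z : {mpoly F[n]}) : Lam (x + y) z = Lam x z + Lam y z.
Proof. by have := exprD_card 1 x y; rewrite expn1 /Lam => ->; ring. Qed.

Lemma LamDr n (x y z : {mpoly F[n]}) : Lam z (x + y) = Lam z x + Lam z y.
Proof. by have := exprD_card 1 x y; rewrite expn1 /Lam => ->; ring. Qed.

Lemma Lamxx (S : comNzRingType) (x : S) : Lam x x = 0.
Proof. by rewrite /Lam subrr. Qed.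

Lemma LamC (S : comNzRingType) (x y : S) : Lam x y = - Lam y x.
Proof. by rewrite /Lam; ring. Qed.

Lemma xvX_inj n i k l : xv F n i ^+ k = xv F n i ^+ l -> k = l.
Proof.
rewrite /xv !mpolyXn => /(congr1 (mmeasure mdeg)).
by rewrite !msizeX !mdegMn !mdeg1 !mul1n => -[].
Qed.

Lemma q_neq1 : (q == 1)%N = false.
Proof. by apply/negbTE; rewrite neq_ltn q_gt1 orbT. Qed.

Lemma Lam12_neq0 : Lam x1 x2 != 0.
Proof.
(* At the point [(1, x)] the form becomes [x ^ q - x]. *)
apply/eqP => /(congr1 (fun f => subst2 f 1 x1)).
rewrite subst2_Lam; subst2E; rewrite /Lam expr1n mul1r mulr1 => /eqP; rewrite subr_eq0.
by rewrite -{2}[x1]expr1 => /eqP /xvX_inj /eqP; rewrite q_neq1.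
Qed.

Lemma x_neq0 n i : xv F n i != 0.
Proof.
by apply/eqP => /(congr1 (mmeasure mdeg)); rewrite msizeX mdeg1 msize0.
Qed.

Definition inV (v : {mpoly F[2]}) := exists a b : F, v = a%:MP * x1 + b%:MP * x2.

Lemma inV_x1 : inV x1.
Proof. by exists 1, 0; rewrite mpolyC1 mpolyC0 mul1r mul0r addr0. Qed.

Lemma inV_x2 : inV x2.
Proof. by exists 0, 1; rewrite mpolyC1 mpolyC0 mul1r mul0r add0r. Qed.

Lemma span_inj a b c d :
  a%:MP * x1 + b%:MP * x2 = c%:MP * x1 + d%:MP * x2 -> (a, b) = (c, d).
Proof.
move=> E; have N : inord 0 != inord 1 :> 'I_2 by rewrite -val_eqE /= !inordK.
have := congr1 (mcoeff U_(inord 0)) E; have := congr1 (mcoeff U_(inord 1)) E.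
rewrite !mcoeffD !mcoeffCM !mcoeffXU !eqxx (negbTE N) eq_sym (negbTE N) /=.
by rewrite !mulr0 !mulr1 !addr0 !add0r => -> ->.
Qed.

Lemma V_poly_eq0 (G : {poly {mpoly F[2]}}) :
  (size G <= q ^ 2)%N -> (forall v, inV v -> G.[v] = 0) -> G = 0.
Proof.
move=> sG G0; apply/eqP; apply: contraLR sG => nz; rewrite -ltnNge.
pose vs := [seq ab.1%:MP * x1 + ab.2%:MP * x2 | ab <- enum {: F * F}].
have <- : size vs = (q ^ 2)%N.
  by rewrite size_map -cardE card_prod -mulnn.
apply: max_poly_roots => //.
  apply/allP => v /mapP [ab _ ->]; rewrite rootE G0 //; by exists ab.1, ab.2.
rewrite map_inj_uniq ?enum_uniq // => -[a b] [c d]; exact: span_inj.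
Qed.

(** The bracket [[s]]: the positive exponents congruent to 1 modulo [q - 1]. In particular 1, [q]
    and [q ^ 2] are [br 0], [br 1] and [br q.+1]. *)
Definition br s := (s * q.-1).+1.

Lemma br_inj : injective br.
Proof.
move=> s t /eqP; rewrite eqSS eqn_pmul2r; first by move/eqP.
by have := q_gt1; lia.
Qed.

(** The largest exponent is [br q = q ^ 2 - q + 1], below [q ^ 2], so [V_poly_eq0] applies; the
    exponents are distinct, so each coefficient vanishes. *)
Lemma V_br_free (w : nat -> {mpoly F[2]}) :
  (forall v, inV v -> \sum_(t < q.+1) w t * v ^+ br t = 0) ->
  forall t, (t <= q)%N -> w t = 0.
Proof.
move=> H t letq.
pose G := \sum_(t < q.+1) (w t) *: 'X^(br t) : {poly {mpoly F[2]}}.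
have G0 : G = 0.
  apply: V_poly_eq0 => [|v /H <-].
    apply: leq_trans (size_sum _ _ _) _; apply/bigmax_leqP => -[i lti] _ /=.
    apply: leq_trans (size_scale_leq _ _) _; rewrite size_polyXn /br.
    have : (i * q.-1 <= q * q.-1)%N by rewrite leq_mul2r -ltnS lti orbT.
    have := q_gt1; rewrite -mulnn; case: (q) => // n; rewrite mulSnr /=.
    by move: (i * n)%N => k; lia.
  rewrite horner_sum; apply: eq_bigr => i _.
  by rewrite hornerZ hornerXn.
have := congr1 (fun p : {poly _} => p`_(br t)) G0; rewrite coef0 => <-.
rewrite coef_sum (bigD1 (inord t)) //= coefZ coefXn inordK // eqxx mulr1.
rewrite big1 ?addr0 // => i nit; rewrite coefZ coefXn.
case: eqP => [/br_inj e|]; last by rewrite mulr0.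
by case/eqP: nit; apply: val_inj; rewrite /= inordK.
Qed.

(** * Dickson invariants in two variables *)

Notation Q0 := (Q F 2 0).
Notation Q1 := (Q F 2 1).

Lemma dicksonProd2E : dicksonProd F 2 =
  \prod_(a : {ffun 'I_2 -> F}) ('X - (- \sum_(j < 2) a j *: 'X_j)%:P).
Proof. by apply: eq_bigr => a _; rewrite polyCN opprK. Qed.

Lemma size_dicksonProd2 : size (dicksonProd F 2) = (q ^ 2).+1.
Proof.
rewrite dicksonProd2E size_prod_XsubC; congr _.+1.
have -> : index_enum {ffun 'I_2 -> F} = enum {ffun 'I_2 -> F} by rewrite enumT.
by rewrite -cardE card_ffun card_ord.
Qed.

Lemma dicksonProd2_lead : (dicksonProd F 2)`_(q ^ 2) = 1.
Proof.
have /monicP : dicksonProd F 2 \is monic by rewrite dicksonProd2E monic_prod_XsubC.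
by rewrite lead_coefE size_dicksonProd2.
Qed.

Lemma dicksonProd2_root v : inV v -> (dicksonProd F 2).[v] = 0.
Proof.
move=> [a [b ev]]; rewrite /dicksonProd horner_prod.
(* The factors of the product are [X + v], so the one that vanishes at [v] is indexed by the
   coefficients of [- v]. *)
pose c := [ffun i : 'I_2 => if i == 0 then - a else - b].
suff E : \sum_(j < 2) c j *: 'X_j = - v.
  have Z : ('X + (\sum_(j < 2) c j *: 'X_j)%:P).[v] = 0.
    by rewrite E hornerD hornerX hornerC subrr.
  by apply/eqP/prodf_eq0; exists c => //; apply/eqP.
rewrite big_ord_recl big_ord1 !ffunE eqxx ev.
have -> : xv F 1 0 = 'X_ord0 by congr 'X_(_); apply: val_inj; rewrite /= inordK.
have -> : xv F 1 1 = 'X_(lift ord0 ord0) by congr 'X_(_); apply: val_inj; rewrite /= inordK.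
by rewrite !scaleNr !mul_mpolyC opprD.
Qed.

(** The right side expands the Moore determinant of [x1, x2, X] along [X], hence vanishes on [V], as
    does the left side. The leading terms agree, so the difference has degree below [q ^ 2]. *)
Lemma dicksonProd2_coef : (Lam x1 x2)%:P * dicksonProd F 2 =
  (Lam x1 x2)%:P * 'X^(q ^ 2)
  - (x1 * x2 ^+ (q ^ 2) - x2 * x1 ^+ (q ^ 2))%:P * 'X^q
  + (x1 ^+ q * x2 ^+ (q ^ 2) - x2 ^+ q * x1 ^+ (q ^ 2))%:P * 'X.
Proof.
have qq : (q < q ^ 2)%N by rewrite -{1}[q]expn1 ltn_exp2l ?q_gt1.
apply/eqP; rewrite -subr_eq0; apply/eqP; apply: V_poly_eq0.
  apply/leq_sizeP => j lej; rewrite coefB coefD coefB !coefCM !coefXn coefX.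
  have -> : (j == q) = false by apply/eqP; lia.
  have -> : (j == 1)%N = false by have := q_gt1; lia.
  case: (ltngtP j (q ^ 2)%N) lej => // [ltj|->] _.
    by rewrite nth_default ?size_dicksonProd2 //=; ring.
  by rewrite dicksonProd2_lead /=; ring.
move=> v Vv; rewrite hornerD hornerN hornerM dicksonProd2_root // hornerD hornerD hornerN !hornerM.
rewrite !hornerC !hornerXn hornerX.
case: Vv => a [b ->].
have := lincomb_card 1 a b x1 x2; rewrite expn1 => ->.
rewrite (lincomb_card 2) /Lam.
move: (x1 ^+ (q ^ 2)) (x2 ^+ (q ^ 2)) (x1 ^+ q) (x2 ^+ q) => A B C D; ring.
Qed.

Lemma Q1_Lam : Q1 * Lam x1 x2 = x1 * x2 ^+ (q ^ 2) - x2 * x1 ^+ (q ^ 2).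
Proof.
have qq : (q < q ^ 2)%N by rewrite -{1}[q]expn1 ltn_exp2l ?q_gt1.
have := congr1 (fun p : {poly _} => p`_q) dicksonProd2_coef.
rewrite coefD coefB !coefCM !coefXn coefX eqxx (ltn_eqF qq) (q_neq1) /= => H.
have -> : Q1 = - (dicksonProd F 2)`_q by rewrite /Q expn1 expr1 mulN1r.
transitivity (- (Lam x1 x2 * (dicksonProd F 2)`_q)); first by ring.
by rewrite H; ring.
Qed.

Lemma Q0_Lam : Q0 * Lam x1 x2 = x1 ^+ q * x2 ^+ (q ^ 2) - x2 ^+ q * x1 ^+ (q ^ 2).
Proof.
have qq : (1 < q ^ 2)%N by rewrite -{1}[1%N](exp1n 2) ltn_exp2r ?q_gt1.
have := congr1 (fun p : {poly _} => p`_1) dicksonProd2_coef.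
rewrite coefD coefB !coefCM !coefXn coefX eqxx (ltn_eqF qq) eq_sym (q_neq1) /= => H.
have -> : Q0 = (dicksonProd F 2)`_1 by rewrite /Q expn0 sqrrN expr1n mul1r.
transitivity (Lam x1 x2 * (dicksonProd F 2)`_1); first by ring.
by rewrite H; ring.
Qed.

(** By additivity of the Frobenius, the right side of [Q0_Lam] is [Lam x1 x2 ^+ q]. *)
Lemma Q0E : Q0 = Lam x1 x2 ^+ q.-1.
Proof.
apply: (mulIf (Lam12_neq0)); rewrite Q0_Lam -exprSr prednK ?(ltnW (q_gt1)) //.
have e1 := exprD_card 1 (x1 * x2 ^+ q) (- (x2 * x1 ^+ q)).
have e2 := exprN_card 1 (x2 * x1 ^+ q).
by rewrite expn1 in e1 e2; rewrite /Lam e1 e2 !exprMn -!exprM !mulnn.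
Qed.

Lemma x1_card2 : x1 ^+ (q ^ 2) = Q1 * x1 ^+ q - Q0 * x1.
Proof.
apply: (mulIf (Lam12_neq0)); set u := Lam x1 x2.
rewrite [RHS](_ : _ = (Q1 * u) * x1 ^+ q - (Q0 * u) * x1); last by ring.
by rewrite Q1_Lam Q0_Lam /u /Lam; ring.
Qed.

Lemma x2_card2 : x2 ^+ (q ^ 2) = Q1 * x2 ^+ q - Q0 * x2.
Proof.
apply: (mulIf (Lam12_neq0)); set u := Lam x1 x2.
rewrite [RHS](_ : _ = (Q1 * u) * x2 ^+ q - (Q0 * u) * x2); last by ring.
by rewrite Q1_Lam Q0_Lam /u /Lam; ring.
Qed.

Lemma inV_card2 v : inV v -> v ^+ (q ^ 2) = Q1 * v ^+ q - Q0 * v.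
Proof.
case=> a [b ->]; have := lincomb_card 1 a b x1 x2; rewrite expn1 => ->.
by rewrite (lincomb_card 2) x1_card2 x2_card2; ring.
Qed.

Lemma inD_Q (i : 'I_2) : inD (Q F 2 i).
Proof. by exists 'X_i; rewrite comp_mpolyXU -tnth_nth tnth_map tnth_ord_tuple. Qed.

Lemma inD_Q0 : inD Q0. Proof. exact: (inD_Q 0). Qed.
Lemma inD_Q1 : inD Q1. Proof. exact: (inD_Q 1). Qed.
Lemma inD_C n c : inD (c%:MP_[n] : {mpoly F[n]}).
Proof. by exists c%:MP; rewrite comp_mpolyC. Qed.
Lemma inD_D n (f g : {mpoly F[n]}) : inD f -> inD g -> inD (f + g).
Proof. by case=> P -> [R ->]; exists (P + R); rewrite rmorphD. Qed.
Lemma inD_M n (f g : {mpoly F[n]}) : inD f -> inD g -> inD (f * g).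
Proof. by case=> P -> [R ->]; exists (P * R); rewrite rmorphM. Qed.
Lemma inD_0 n : inD (0 : {mpoly F[n]}). Proof. by rewrite -mpolyC0; apply: inD_C. Qed.
Lemma inD_1 n : inD (1 : {mpoly F[n]}). Proof. by rewrite -mpolyC1; apply: inD_C. Qed.
Lemma inD_N n (f : {mpoly F[n]}) : inD f -> inD (- f).
Proof. by case=> P ->; exists (- P); rewrite rmorphN. Qed.
Lemma inD_B n (f g : {mpoly F[n]}) : inD f -> inD g -> inD (f - g).
Proof. by move=> Df Dg; apply: inD_D => //; apply: inD_N. Qed.
Lemma inD_X n (f : {mpoly F[n]}) k : inD f -> inD (f ^+ k).
Proof. by move=> Df; elim: k => [|k IH]; [exact: inD_1 | rewrite exprS; apply: inD_M]. Qed.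

Lemma inD_ind (S : {mpoly F[2]} -> Prop) :
  (forall c, S c%:MP) -> (forall f g, S f -> S g -> S (f + g)) ->
  (forall f, S f -> S (Q0 * f)) -> (forall f, S f -> S (Q1 * f)) ->
  forall d, inD d -> S d.
Proof.
move=> SC SD S0 S1 d [P ->]; rewrite comp_mpolyE.
apply: (big_ind S) => [|//|m _]; first by rewrite -mpolyC0.
rewrite -mul_mpolyC big_ord_recl big_ord1 !tnth_map !tnth_ord_tuple /=.
rewrite mulrC -mulrA; elim: (m _) => [|k IH]; last by rewrite exprS -mulrA; apply: S0.
rewrite expr0 mul1r; elim: (m _) => [|k IH]; last by rewrite exprS -mulrA; apply: S1.
by rewrite expr0 mul1r.
Qed.

(** The transvection fixes [Lam x1 x2] and the right sides of [Q0_Lam] and [Q1_Lam], hence also the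
    quotients. *)
Lemma subst2_Q_T i : (i < 2)%N -> subst2 (Q F 2 i) (x1 + x2) x2 = Q F 2 i.
Proof.
have E k : (x1 + x2) ^+ (q ^ k) = x1 ^+ (q ^ k) + x2 ^+ (q ^ k) by apply: exprD_card.
have E1 := E 1%N; have E2 := E 2%N; rewrite expn1 in E1.
have TL : subst2 (Lam x1 x2) (x1 + x2) x2 = Lam x1 x2.
  by rewrite subst2_Lam; subst2E; rewrite /Lam E1; ring.
case: i => [|[|//]] _; apply: (mulIf (Lam12_neq0)); rewrite -{1}TL -subst2M.
  by rewrite Q0_Lam; subst2E; rewrite E1 E2; ring.
by rewrite Q1_Lam; subst2E; rewrite E2; ring.
Qed.

Lemma inD_T d : inD d -> subst2 d (x1 + x2) x2 = d.
Proof.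
move: d; apply: inD_ind => [c|f g Ef Eg|f Ef|f Ef].
- exact: subst2C.
- by rewrite subst2D Ef Eg.
- by rewrite subst2M subst2_Q_T // Ef.
- by rewrite subst2M subst2_Q_T // Ef.
Qed.

#[local] Opaque Q.

(** * Reduction modulo the Dickson polynomial *)

Lemma br0 : br 0 = 1%N. Proof. by []. Qed.

Lemma br1 : br 1 = q.
Proof. by rewrite /br mul1n prednK // ltnW // q_gt1. Qed.

(** Since [q ^ m] is 1 modulo [q - 1], the powers [x ^ (q ^ m)] belong to the same family as the [x
    ^ [s]]. *)
Lemma card_brE m : exists r, (q ^ m)%N = br r.
Proof.
elim: m => [|m [r IH]]; first by exists 0%N.
exists (q * r).+1; rewrite expnS IH /br.
have := q_gt1; case: (q) => // n _ /=; nia.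
Qed.

Lemma br_addq s : (br (s + q.+1) + 1 = br s + q ^ 2)%N.
Proof.
rewrite /br -mulnn; have := q_gt1; case: (q) => // n _ /=; nia.
Qed.

(* For q^m = br r this is delta_{2;m}(x1^(s(q-1))), see [delta2E]. *)
Definition upoly (S : comNzRingType) r s (a b : S) : S :=
  let A := a ^+ q.-1 in let B := b ^+ q.-1 in
  if (s <= r)%N then (A * B) ^+ s * \sum_(i < r - s) B ^+ ((r - s).-1 - i) * A ^+ i
  else - ((A * B) ^+ r * \sum_(i < s - r) B ^+ ((s - r).-1 - i) * A ^+ i).

Lemma exprbr (S : comNzRingType) (a : S) s : a ^+ br s = a * (a ^+ q.-1) ^+ s.
Proof. by rewrite /br exprS mulnC exprM. Qed.

Lemma exprq (S : comNzRingType) (a : S) : a ^+ q = a * a ^+ q.-1.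
Proof. by rewrite -exprS prednK // ltnW // q_gt1. Qed.

(** With [A = a ^ (q-1)] and [B = b ^ (q-1)], [Lam a b] is [a b (B - A)], and [B - A] times the
    geometric sum telescopes to a difference of powers. *)
Lemma Lam_upoly (S : comNzRingType) r s (a b : S) :
  Lam a b * upoly r s a b = b ^+ br r * a ^+ br s - a ^+ br r * b ^+ br s.
Proof.
rewrite /Lam -br1 !exprbr !expr1 /upoly.
move: (a ^+ q.-1) (b ^+ q.-1) => A B.
have E n : (B - A) * \sum_(i < n) B ^+ (n.-1 - i) * A ^+ i = B ^+ n - A ^+ n.
  by rewrite subrXX.
case: leqP => [les|/ltnW les].
  rewrite (_ : _ * _ = a * b * (A * B) ^+ s *
    ((B - A) * \sum_(i < r - s) B ^+ ((r - s).-1 - i) * A ^+ i)); last by ring.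
  rewrite E exprMn -{3 4}(subnK les) !exprD; ring.
rewrite (_ : _ * _ = - (a * b * (A * B) ^+ r *
    ((B - A) * \sum_(i < s - r) B ^+ ((s - r).-1 - i) * A ^+ i))); last by ring.
rewrite E exprMn -{3 4}(subnK les) !exprD; ring.
Qed.

Lemma subst2_mon n (c : F) (m : 'X_{1..2}) (a b : {mpoly F[n]}) :
  subst2 (c *: 'X_[m]) a b = c%:MP * (a ^+ m ord0 * b ^+ m ord_max).
Proof.
rewrite /subst2 comp_mpolyZ comp_mpolyX mul_mpolyC big_ord_recl big_ord1.
by rewrite !(tnth_nth 0) /= (_ : lift ord0 ord0 = ord_max) //; apply: val_inj.
Qed.

(** These are the invariants of the diagonal torus of [GL_2]. *)
Definition toric f := exists g : {mpoly F[2]}, f = subst2 g (x1 ^+ q.-1) (x2 ^+ q.-1).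

Lemma toric_D f g : toric f -> toric g -> toric (f + g).
Proof. by move=> [u ->] [v ->]; exists (u + v); rewrite subst2D. Qed.
Lemma toric_C c : toric c%:MP.
Proof. by exists c%:MP; rewrite subst2C. Qed.
Lemma toric_M f g : toric f -> toric g -> toric (f * g).
Proof. by move=> [u ->] [v ->]; exists (u * v); rewrite subst2M. Qed.
Lemma toric_x1 : toric (x1 ^+ q.-1).
Proof. by exists x1; rewrite subst2_x1. Qed.
Lemma toric_x2 : toric (x2 ^+ q.-1).
Proof. by exists x2; rewrite subst2_x2. Qed.
Lemma toric_X f k : toric f -> toric (f ^+ k).
Proof. by move=> [u ->]; exists (u ^+ k); rewrite subst2X. Qed.
Lemma toric_0 : toric 0. Proof. by rewrite -mpolyC0; apply: toric_C. Qed.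
Lemma toric_sum (I : Type) (r : seq I) (P : pred I) (f : I -> {mpoly F[2]}) :
  (forall i, P i -> toric (f i)) -> toric (\sum_(i <- r | P i) f i).
Proof. by move=> H; apply: big_ind => //; [exact: toric_0 | exact: toric_D]. Qed.

Lemma toric_ind (S : {mpoly F[2]} -> Prop) :
  S 0 -> (forall f g, S f -> S g -> S (f + g)) ->
  (forall c i j, S (c%:MP * ((x1 ^+ q.-1) ^+ i * (x2 ^+ q.-1) ^+ j))) ->
  forall f, toric f -> S f.
Proof.
move=> S0 SD SM f [g ->]; elim/mpolyind: g => [|c m p _ _ IH].
  by rewrite subst2_0.
by rewrite subst2D; apply: SD => //; rewrite subst2_mon.
Qed.

(* The relation a A + b B = Q0^k recovers Q0^k f from A f and B f. *)
Lemma card_reduce m : exists A B a b k, [/\ inD A, inD B, inD a & inD b] /\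
  a * A + b * B = Q0 ^+ k /\
  forall n (v1 v2 z : {mpoly F[n]}), exists K, z ^+ (q ^ m) =
    subst2 A v1 v2 * z ^+ q + subst2 B v1 v2 * z +
    (z ^+ (q ^ 2) - subst2 Q1 v1 v2 * z ^+ q + subst2 Q0 v1 v2 * z) * K.
Proof.
have fD n (x y : {mpoly F[n]}) : (x + y) ^+ q = x ^+ q + y ^+ q.
  by have := exprD_card 1 x y; rewrite expn1.
elim: m => [|m [A [B [a [b [k [[DA DB Da Db] [E H]]]]]]]].
  exists 0, 1, 0, 1, 0%N; split.
    by split; [exact: inD_0|exact: inD_1|exact: inD_0|exact: inD_1].
  split; first by rewrite mul0r mulr1 add0r.
  by move=> n v1 v2 z; exists 0; rewrite subst2_0 subst2_1 expr1; ring.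
have DQ0 := inD_Q0; have DQ1 := inD_Q1.
(* The new [A] and [B] come from raising the reduction of [z ^ (q ^ m)] to the power [q] and
   replacing [z ^ (q ^ 2)]. The new [a] and [b] make the [Q1] terms cancel, leaving
   [Q0 (a A + b B) ^ q], whence the exponent [k q + 1]. *)
exists (A ^+ q * Q1 + B ^+ q), (- (Q0 * A ^+ q)), (b ^+ q * Q0), (b ^+ q * Q1 - a ^+ q), (k * q).+1.
split.
  by split; repeat first
    [apply: inD_D | apply: inD_N | apply: inD_M | apply: inD_X] => //.
split.
  rewrite exprSr exprM -E fD !exprMn; ring.
move=> n v1 v2 z; have [K EK] := H n v1 v2 z.
set P := _ - _ + _ in EK *.
have EP : P ^+ q = P * P ^+ q.-1 by rewrite -exprS prednK // ltnW // q_gt1.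
have EZ : z ^+ (q ^ 2) = P + subst2 Q1 v1 v2 * z ^+ q - subst2 Q0 v1 v2 * z.
  by rewrite /P; ring.
exists (subst2 A v1 v2 ^+ q + P ^+ q.-1 * K ^+ q).
rewrite expnSr exprM EK !fD !exprMn -(exprM z) mulnn EZ EP.
rewrite subst2D subst2N !subst2M !subst2X; ring.
Qed.

(** Strong induction with the recursion [v ^ [s] = Q1 v ^ [s-q] - Q0 v ^ [s-q-1]], which is
    [inV_card2] times a power of [v ^ (q-1)]. *)
Lemma br_reduce s : exists r : nat -> {mpoly F[2]}, (forall t, inD (r t)) /\
  forall v, inV v -> v ^+ br s = \sum_(t < q.+1) r t * v ^+ br t.
Proof.
elim/ltn_ind: s => s IH; case: (leqP s q) => [les|lts].
  exists (fun t => (t == s)%:R); split.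
    by move=> t; case: eqP => _; [exact: inD_1|exact: inD_0].
  move=> v _; rewrite (bigD1 (Ordinal (les : s < q.+1)%N)) //= eqxx mul1r.
  by rewrite big1 ?addr0 // => i; rewrite -val_eqE /= => /negbTE ->; rewrite mul0r.
have [|r1 [D1 E1]] := IH (s - q)%N; first by have := q_gt1; lia.
have [|r0 [D0 E0]] := IH (s - q.+1)%N; first by lia.
exists (fun t => Q1 * r1 t - Q0 * r0 t); split.
  by move=> t; apply: inD_B; apply: inD_M => //; [exact: inD_Q1|exact: inD_Q0].
move=> v Vv.
transitivity (Q1 * v ^+ br (s - q) - Q0 * v ^+ br (s - q.+1)); last first.
  rewrite E1 // E0 // !mulr_sumr -sumrB; apply: eq_bigr => t _; ring.
have -> : v ^+ br s = (v ^+ q.-1) ^+ (s - q.+1) * v ^+ (q ^ 2).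
  rewrite -exprM -exprD; congr (_ ^+ _).
  have := br_addq (s - q.+1); rewrite subnK // /br mulnC; lia.
rewrite inV_card2 // !exprbr (_ : (s - q = (s - q.+1).+1)%N); last by lia.
rewrite exprS (_ : v ^+ q = v * v ^+ q.-1); last by rewrite -exprS prednK // ltnW // q_gt1.
ring.
Qed.

(** The factor [Lam x y] turns the monomial with exponents [i, j] in [x ^ (q-1), y ^ (q-1)] into [x
    ^ [i] y ^ [j+1] - x ^ [i+1] y ^ [j]], where [br_reduce] applies to each power. *)
Lemma toric_reduce f : toric f -> exists D : nat -> nat -> {mpoly F[2]},
  (forall t s, inD (D t s)) /\ forall x y, inV x -> inV y ->
  Lam x y * subst2 f x y =
  \sum_(s < q.+1) (\sum_(t < q.+1) D t s * x ^+ br t) * y ^+ br s.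
Proof.
move: f; apply: toric_ind => [|f g [D1 [DD1 E1]] [D2 [DD2 E2]]|c i j].
- exists (fun _ _ => 0); split=> [t s|x y _ _]; first exact: inD_0.
  rewrite subst2_0 mulr0 big1 // => s _; rewrite big1 ?mul0r // => t _.
  by rewrite mul0r.
- exists (fun t s => D1 t s + D2 t s); split=> [t s|x y Vx Vy].
    exact: inD_D.
  rewrite subst2D mulrDr E1 // E2 // -big_split; apply: eq_bigr => s _ /=.
  rewrite -mulrDl -big_split; congr (_ * _); apply: eq_bigr => t _ /=.
  by rewrite mulrDl.
have [r1 [D1 E1]] := br_reduce i; have [r2 [D2 E2]] := br_reduce j.+1.
have [r3 [D3 E3]] := br_reduce i.+1; have [r4 [D4 E4]] := br_reduce j.
exists (fun t s => c%:MP * (r1 t * r2 s - r3 t * r4 s)); split=> [t s|x y Vx Vy].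
  apply: inD_M; first exact: inD_C.
  by apply: inD_B; apply: inD_M.
transitivity (c%:MP * (x ^+ br i * y ^+ br j.+1 - x ^+ br i.+1 * y ^+ br j)).
  rewrite subst2M subst2C subst2M !subst2X subst2_x1 subst2_x2 !exprbr !exprS.
  by rewrite /Lam !exprq; ring.
rewrite E1 // E2 // E3 // E4 // !mulr_sumr -sumrB mulr_sumr.
apply: eq_bigr => s _; rewrite [X in _ = X * _](_ : _ = c%:MP *
  ((\sum_(t < q.+1) r1 t * x ^+ br t) * r2 s -
   (\sum_(t < q.+1) r3 t * x ^+ br t) * r4 s)); first by ring.
rewrite !mulr_suml -sumrB mulr_sumr; apply: eq_bigr => t _; ring.
Qed.

(** * The membership condition *)

Lemma hat_subst2 j i k (f : {mpoly F[2]}) : (j < 3)%N -> (i < 3)%N -> (k < 3)%N ->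
  bump j 0 = i -> bump j 1 = k ->
  f \mPo [tuple 'X_(lift (inord j : 'I_3) l) | l < 2] = subst2 f (xv F 2 i) (xv F 2 k).
Proof.
move=> lj li lk ei ek; rewrite /subst2; congr comp_mpoly.
apply: eq_from_tnth => l; rewrite tnth_map tnth_ord_tuple (tnth_nth 0).
case: l => [[|[|//]]] lt /=; congr 'X_(_); apply: val_inj; rewrite /= !inordK //.
Qed.

Lemma Ndelta3E m f : Ndelta 3 m f =
  y1 ^+ (q ^ m) * (subst2 f y2 y3 * Lam y2 y3) - y2 ^+ (q ^ m) * (subst2 f y1 y3 * Lam y1 y3)
  + y3 ^+ (q ^ m) * (subst2 f y1 y2 * Lam y1 y2).
Proof.
rewrite /Ndelta (det33 (fun t j => if t == 2%N then xv F 2 j ^+ (q ^ m) *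
  (f \mPo [tuple 'X_(lift (inord j : 'I_3) l) | l < 2]) else xv F 2 j ^+ (q ^ t))) /=.
rewrite (@hat_subst2 0 1 2) // (@hat_subst2 1 0 2) // (@hat_subst2 2 0 1) //.
rewrite expn0 expn1 !expr1 /Lam.
move: (subst2 f _ _) (subst2 f _ _) (subst2 f _ _) => f1 f2 f3.
move: (y1 ^+ q) (y2 ^+ q) (y3 ^+ q) => a b c.
move: (y1 ^+ (q ^ m)) (y2 ^+ (q ^ m)) (y3 ^+ (q ^ m)) => a' b' c'; ring.
Qed.

(** Both [Ndelta3E] and [Lmoore3E] have this shape, the latter with cofactors [1], so one lemma
    specialises the two determinants. *)
Lemma rmorph_cyc (S T : comNzRingType) (phi : {rmorphism S -> T}) e
    (a b c f g h : S) (a' b' c' f' g' h' : T) :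
  phi a = a' -> phi b = b' -> phi c = c' -> phi f = f' -> phi g = g' -> phi h = h' ->
  phi (a ^+ e * (f * Lam b c) - b ^+ e * (g * Lam a c)
    + c ^+ e * (h * Lam a b)) =
  a' ^+ e * (f' * Lam b' c') - b' ^+ e * (g' * Lam a' c')
    + c' ^+ e * (h' * Lam a' b').
Proof.
move=> <- <- <- <- <- <-; rewrite /Lam rmorphD !rmorphB.
by rewrite !rmorphM !rmorphB !rmorphM !rmorphXn.
Qed.

Lemma Lmoore3E : Lmoore F 2 3 =
  y1 ^+ (q ^ 2) * (1 * Lam y2 y3) - y2 ^+ (q ^ 2) * (1 * Lam y1 y3)
  + y3 ^+ (q ^ 2) * (1 * Lam y1 y2).
Proof.
rewrite /Lmoore (det33 (fun t j => xv F 2 j ^+ (q ^ t))).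
by rewrite expn0 expn1 !expr1 /Lam; ring.
Qed.

(* Specialising to (1, y, y^2) turns the Moore determinant into a Vandermonde one. *)
Lemma Lmoore3_neq0 : Lmoore F 2 3 != 0.
Proof.
have qq : (1 < q ^ 2)%N by rewrite -{1}[1%N](exp1n 2) ltn_exp2r ?q_gt1.
have qq2 : (q < q ^ 2)%N by rewrite -{1}[q]expn1 ltn_exp2l ?q_gt1.
apply/eqP => /(congr1 (comp_mpoly [tuple 1; x1; x1 ^+ 2])).
rewrite Lmoore3E.
rewrite (rmorph_cyc (phi := comp_mpoly [tuple 1; x1; x1 ^+ 2]) _
  (xv_comp _ _) (xv_comp _ _) (xv_comp _ _) (comp_mpoly1 _) (comp_mpoly1 _) (comp_mpoly1 _)) //=.
rewrite comp_mpoly0 /Lam !expr1n => E.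
have : (x1 ^+ q - x1) * (x1 ^+ (q ^ 2) - x1) * (x1 ^+ (q ^ 2) - x1 ^+ q) = 0.
  have X2 k : (x1 ^+ 2) ^+ k = (x1 ^+ k) ^+ 2 by rewrite exprAC.
  rewrite -E !X2.
  by move: (x1 ^+ q) (x1 ^+ (q ^ 2)) => b c; ring.
move/eqP; rewrite !mulf_eq0 !subr_eq0 -!orbA => /or3P [] /eqP.
- by rewrite -{2}[x1]expr1 => /xvX_inj e; have := q_gt1; rewrite e.
- by rewrite -{2}[x1]expr1 => /xvX_inj e; rewrite e in qq.
- by move/xvX_inj => e; rewrite e ltnn in qq2.
Qed.

Lemma inA2P m (f : {mpoly F[2]}) :
  inA m f <-> exists p, Ndelta 3 m f = Lmoore F 2 3 * p.
Proof.
have L0 : toF (Lmoore F 2 3) != 0 by rewrite /toF tofrac_eq0 Lmoore3_neq0.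
split=> -[p E]; exists p.
  apply: toF_inj; rewrite [in RHS]/toF tofracM -/(toF p) -E /delta.
  by rewrite mulrC divfK.
by rewrite /delta E /toF tofracM mulrAC mulfV ?mul1r.
Qed.

Lemma Ndelta2E m s : Ndelta 2 m ((xv F 0 0) ^+ (s * (q - 1))) =
  x2 ^+ (q ^ m) * x1 ^+ br s - x1 ^+ (q ^ m) * x2 ^+ br s.
Proof.
rewrite /Ndelta (det22 (fun t j => if t == 1%N then xv F 1 j ^+ (q ^ m) *
  ((xv F 0 0) ^+ (s * (q - 1)) \mPo [tuple 'X_(lift (inord j : 'I_2) l) | l < 1])
  else xv F 1 j ^+ (q ^ t))) /=.
have X0 (f : 'I_1 -> {mpoly F[2]}) : xv F 0 0 \mPo [tuple f l | l < 1] = f ord0.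
  by rewrite comp_mpolyXU -tnth_nth tnth_mktuple ord1.
rewrite !comp_mpolyXn !X0.
have -> : lift (inord 0 : 'I_2) ord0 = inord 1.
  by apply: val_inj; rewrite /= !inordK.
have -> : lift (inord 1 : 'I_2) ord0 = inord 0.
  by apply: val_inj; rewrite /= !inordK.
by rewrite expr1 subn1 /br !exprS; ring.
Qed.

Lemma Lmoore2E : Lmoore F 1 2 = Lam x1 x2.
Proof.
rewrite /Lmoore (det22 (fun t j => xv F 1 j ^+ (q ^ t))) expn0 expn1 !expr1.
by rewrite /Lam; ring.
Qed.

Lemma delta2E m r s : (q ^ m)%N = br r ->
  @delta F 1 2 m ((xv F 0 0) ^+ (s * (q - 1))) = toF (upoly r s x1 x2).
Proof.
move=> er; rewrite /delta Ndelta2E Lmoore2E er -Lam_upoly /toF tofracM.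
by rewrite mulrAC mulfV ?mul1r // tofrac_eq0 Lam12_neq0.
Qed.

(** At [y3 = v] the columns of the Moore determinant become linearly dependent, so this determinant
    and its multiple [Ndelta 3 m f] vanish. *)
Lemma inA_V m f v : inA m f -> inV v ->
  x1 ^+ (q ^ m) * (subst2 f x2 v * Lam x2 v) - x2 ^+ (q ^ m) * (subst2 f x1 v * Lam x1 v)
  + v ^+ (q ^ m) * (f * Lam x1 x2) = 0.
Proof.
case/inA2P => p /(congr1 (comp_mpoly [tuple x1; x2; v])) E [a [b ev]]; move: E.
have -> : (Lmoore F 2 3 * p) \mPo [tuple x1; x2; v] = 0.
  rewrite comp_mpolyM Lmoore3E (rmorph_cyc (phi := comp_mpoly [tuple x1; x2; v]) _
    (xv_comp _ _) (xv_comp _ _) (xv_comp _ _)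
    (comp_mpoly1 _) (comp_mpoly1 _) (comp_mpoly1 _)) //= ev (lincomb_card 2) !Lam_lincombr !Lamxx.
  by rewrite (LamC x2 x1); ring.
rewrite Ndelta3E (rmorph_cyc (phi := comp_mpoly [tuple x1; x2; v]) _
  (xv_comp _ _) (xv_comp _ _) (xv_comp _ _)
  (subst2_subst2 _ _ _ _) (subst2_subst2 _ _ _ _) (subst2_subst2 _ _ _ _)) //.
by rewrite !xv_comp //= subst2_id.
Qed.

Lemma inA_sym m f : inA m f -> subst2 f x2 x1 = f.
Proof.
move=> /inA_V /(_ (inV_x1)); rewrite Lamxx !mulr0 subr0 (LamC x2 x1).
move=> E; have : x1 ^+ (q ^ m) * Lam x1 x2 * (f - subst2 f x2 x1) = 0 by rewrite -E; ring.
move/eqP; rewrite !mulf_eq0 expf_eq0 (negbTE (x_neq0 1 0)) andbF.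
by rewrite (negbTE (Lam12_neq0)) subr_eq0 => /eqP.
Qed.

Lemma inA_scale2 m f c : c != 0 -> inA m f -> subst2 f x1 (c%:MP * x2) = f.
Proof.
move=> c0 Af; have Vc : inV (c%:MP * x2).
  by exists 0, c; rewrite mpolyC0 mul0r add0r.
have := inA_V Af Vc.
have Lc x : Lam x (c%:MP * x2) = c%:MP * Lam x x2.
  by have := Lam_lincombr x1 x2 x 0 c; rewrite mpolyC0 !mul0r !add0r.
rewrite !Lc Lamxx !mulr0 add0r exprMn mpolyC_card => E.
have : c%:MP * x2 ^+ (q ^ m) * Lam x1 x2 * (f - subst2 f x1 (c%:MP * x2)) = 0.
  by rewrite -E; ring.
move/eqP; rewrite !mulf_eq0 expf_eq0 (negbTE (x_neq0 1 1)) andbF mpolyC_eq0.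
by rewrite (negbTE c0) (negbTE (Lam12_neq0)) subr_eq0 => /eqP.
Qed.

Lemma inA_scale1 m f c : c != 0 -> inA m f -> subst2 f (c%:MP * x1) x2 = f.
Proof.
move=> c0 Af; have Ef := inA_sym Af; have := inA_scale2 c0 Af.
move/(congr1 (fun g => subst2 g x2 x1)); rewrite Ef {1}/subst2 subst2_subst2.
rewrite comp_mpolyM comp_mpolyC !xv_comp //= => E; rewrite -{1}Ef.
by rewrite {1}/subst2 subst2_subst2 !xv_comp.
Qed.

(** Otherwise the remainder [i %% q.-1] is positive and [X ^ (i %% q.-1) - 1] has all [q - 1]
    nonzero scalars as roots, more than its degree. *)
Lemma expf_all1_dvd i : (forall c : F, c != 0 -> c ^+ i = 1) -> (q.-1 %| i)%N.
Proof.
move=> H; rewrite /dvdn; apply: contraT; rewrite -lt0n => r0.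
have q1 : (0 < q.-1)%N by have := q_gt1; lia.
have Hr c : c \in enum (predC1 (0 : F)) -> c ^+ (i %% q.-1) = 1.
  rewrite mem_enum => c0; have := H c c0.
  rewrite {1}(divn_eq i q.-1) exprD mulnC exprM (_ : c ^+ q.-1 = 1) ?expr1n ?mul1r //.
  apply: (mulfI c0); rewrite -exprS prednK ?expf_card ?mulr1 //.
  by rewrite ltnW // q_gt1.
have := @max_unity_roots F _ (enum (predC1 (0 : F))) r0.
rewrite enum_uniq -cardE cardC1 leqNgt ltn_mod q1 => H2.
by suff : false by []; apply: H2 => //; apply/allP => c /Hr; rewrite unity_rootE => ->.
Qed.

Lemma mcoeff_scale f a b (m : 'X_{1..2}) :
  (subst2 f (a%:MP * x1) (b%:MP * x2))@_m = f@_m * (a ^+ m ord0 * b ^+ m ord_max).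
Proof.
elim/mpolyind: f => [|c k p _ _ IH]; first by rewrite subst2_0 mcoeff0 mul0r.
rewrite subst2D !mcoeffD mulrDl IH; congr (_ + _).
have E : 'X_[k] = x1 ^+ k ord0 * x2 ^+ k ord_max :> {mpoly F[2]}.
  by rewrite -[LHS]subst2_id -['X_[k]]scale1r subst2_mon mpolyC1 mul1r.
have -> : subst2 (c *: 'X_[k]) (a%:MP * x1) (b%:MP * x2) =
    (c * (a ^+ k ord0 * b ^+ k ord_max)) *: 'X_[k].
  have CX (u : F) e : (u ^+ e)%:MP = u%:MP ^+ e :> {mpoly F[2]} by exact: rmorphXn.
  rewrite subst2_mon -mul_mpolyC E !exprMn !mpolyCM !CX.
  by ring.
rewrite !mcoeffZ mcoeffX; case: eqP => [->|_]; last by rewrite !mulr0 mul0r.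
by rewrite !mulr1.
Qed.

(** Scaling either variable by a nonzero [c] fixes [f], so every exponent [i] in its support
    satisfies [c ^ i = 1] for all such [c]. *)
Lemma inA_toric m (f : {mpoly F[2]}) : inA m f -> toric f.
Proof.
move=> Af; rewrite [f]mpolyE big_seq; apply: toric_sum => k kf.
have fk : f@_k != 0 by rewrite -mcoeff_msupp.
have k0 : (q.-1 %| k ord0)%N.
  apply: expf_all1_dvd => c c0; apply: (mulfI fk).
  have := mcoeff_scale f c 1 k; rewrite mpolyC1 mul1r (inA_scale1 c0 Af).
  by rewrite expr1n !mulr1.
have k1 : (q.-1 %| k ord_max)%N.
  apply: expf_all1_dvd => c c0; apply: (mulfI fk).
  have := mcoeff_scale f 1 c k; rewrite mpolyC1 mul1r (inA_scale2 c0 Af).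
  by rewrite expr1n mul1r mulr1.
have -> : f@_k *: 'X_[k] = (f@_k)%:MP * ((x1 ^+ q.-1) ^+ (k ord0 %/ q.-1) *
    (x2 ^+ q.-1) ^+ (k ord_max %/ q.-1)) :> {mpoly F[2]}.
  by rewrite -[LHS]subst2_id subst2_mon -!exprM ![(q.-1 * _)%N]mulnC !divnK.
apply: toric_M; first exact: toric_C.
by apply: toric_M; apply: toric_X; [exact: toric_x1 | exact: toric_x2].
Qed.

(** * Reduction of the elements of A *)

Lemma sum_delta (n j : nat) (c : {mpoly F[2]}) (y : nat -> {mpoly F[2]}) : (j < n)%N ->
  \sum_(s < n) (if (s : nat) == j then c else 0) * y s = c * y j.
Proof.
move=> ltj; rewrite (bigD1 (Ordinal ltj)) //= eqxx big1 ?addr0 // => i.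
by rewrite -val_eqE /= => /negbTE ->; rewrite mul0r.
Qed.

Lemma inA_reduce m r (f : {mpoly F[2]}) : (q ^ m)%N = br r -> inA m f ->
  exists k (d : nat -> {mpoly F[2]}), (forall t, inD (d t)) /\
    Q0 ^+ k * f = \sum_(t < q.+1) d t * upoly r t x1 x2.
Proof.
move=> er Af.
have [D [DD ED]] := toric_reduce (inA_toric Af).
have [A [B [a [b [k [[DA DB Da Db] [EAB H]]]]]]] := card_reduce m.
pose e s x := \sum_(t < q.+1) D t s * x ^+ br t.
have EDc x y : inV x -> inV y ->
    subst2 f x y * Lam x y = \sum_(s < q.+1) e s x * y ^+ br s.
  by move=> Vx Vy; rewrite mulrC ED.
(* [w s] is the coefficient of [v ^ [s]] in [inA_V] after reduction; [A] and [B] enter at [s = 1]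
   and [s = 0] because [v ^ q = v ^ [1]] and [v = v ^ [0]]. *)
pose w s := x1 ^+ (q ^ m) * e s x2 - x2 ^+ (q ^ m) * e s x1
  + (if s == 1%N then f * Lam x1 x2 * A else 0)
  + (if s == 0%N then f * Lam x1 x2 * B else 0).
have w0 t : (t <= q)%N -> w t = 0.
  apply: V_br_free => v Vv; rewrite -[RHS](inA_V Af Vv) {t}.
  have Ev : v ^+ (q ^ m) = A * v ^+ q + B * v.
    have [K EK] := H 2 x1 x2 v; rewrite !subst2_id inV_card2 // in EK.
    by rewrite EK; ring.
  rewrite Ev (EDc _ _ (inV_x1) Vv) (EDc _ _ (inV_x2) Vv).
  transitivity (x1 ^+ (q ^ m) * (\sum_(s < q.+1) e s x2 * v ^+ br s) -
    x2 ^+ (q ^ m) * (\sum_(s < q.+1) e s x1 * v ^+ br s) +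
    (f * Lam x1 x2 * A * v ^+ br 1 + f * Lam x1 x2 * B * v ^+ br 0)).
    rewrite -(@sum_delta q.+1 1 _ (fun s => v ^+ br s)); last by rewrite ltnS ltnW // q_gt1.
    rewrite -(@sum_delta q.+1 0 _ (fun s => v ^+ br s)) //.
    rewrite !mulr_sumr -sumrB -!big_split /=; apply: eq_bigr => s _.
    rewrite /w; move: (if _ then _ else _) (if _ then _ else _) (e s x1) (e s x2) => c0 c1 c2 c3.
    by move: (x1 ^+ _) (x2 ^+ _) (v ^+ _) => c4 c5 c6; ring.
  rewrite br1 br0 expr1; congr (_ + _).
  by move: (v ^+ q) (Lam x1 x2) => vq l; ring.
(* The relations [w 1 = 0] and [w 0 = 0], divided by [Lam x1 x2], express [A f] and [B f] through
   the [upoly]. *)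
have E t c : (t <= q)%N -> x1 ^+ (q ^ m) * e t x2 - x2 ^+ (q ^ m) * e t x1
    + f * Lam x1 x2 * c = 0 -> c * f = \sum_(s < q.+1) D s t * upoly r s x1 x2.
  move=> letq E0; apply: (mulfI (Lam12_neq0)).
  transitivity (x2 ^+ (q ^ m) * e t x1 - x1 ^+ (q ^ m) * e t x2).
    rewrite (mulrC c) mulrA (mulrC _ f).
    by move/eqP: E0; rewrite addrC addr_eq0 opprB => /eqP.
  rewrite /e er !mulr_sumr -sumrB; apply: eq_bigr => s _.
  rewrite [RHS]mulrCA Lam_upoly.
  by move: (x1 ^+ br r) (x2 ^+ br r) (x1 ^+ br s) (x2 ^+ br s) => c0 c1 c2 c3; ring.
have lt1 : (1 <= q)%N by rewrite ltnW // q_gt1.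
have EA : A * f = \sum_(s < q.+1) D s 1%N * upoly r s x1 x2.
  by apply: E => //; rewrite -[RHS](w0 1%N lt1) /w /= addr0.
have EB : B * f = \sum_(s < q.+1) D s 0%N * upoly r s x1 x2.
  by apply: E => //; rewrite -[RHS](w0 0%N isT) /w /= addr0.
exists k, (fun t => a * D t 1%N + b * D t 0%N); split.
  by move=> t; apply: inD_D; apply: inD_M.
rewrite -EAB mulrDl -!mulrA EA EB !mulr_sumr -big_split; apply: eq_bigr => s _ /=.
by ring.
Qed.

(** On [V] the power [v ^ (q ^ m)] is [A v ^ q + B v] with [A], [B] in [D_2], and Cramer's rule at
    [x1, x2] recovers [A] as this [upoly]. *)
Lemma upoly0_inD m r : (q ^ m)%N = br r -> inD (upoly r 0 x1 x2).
Proof.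
move=> er; have [A [B [_ [_ [_ [[DA _ _ _] [_ H]]]]]]] := card_reduce m.
suff -> : upoly r 0 x1 x2 = A by [].
have E v : inV v -> v ^+ br r = A * v ^+ q + B * v.
  move=> Vv; have [K] := H 2 x1 x2 v; rewrite !subst2_id inV_card2 // er => ->.
  by ring.
apply: (mulfI (Lam12_neq0)); rewrite Lam_upoly br0 !expr1 !E ?inV_x1 ?inV_x2 //;
  [|exact: inV_x1|exact: inV_x2].
by rewrite /Lam; ring.
Qed.

Lemma upoly1_inD m r : (q ^ m)%N = br r -> inD (upoly r 1 x1 x2).
Proof.
move=> er; have [A [B [_ [_ [_ [[_ DB _ _] [_ H]]]]]]] := card_reduce m.
suff -> : upoly r 1 x1 x2 = - B by apply: inD_N.
have E v : inV v -> v ^+ br r = A * v ^+ q + B * v.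
  move=> Vv; have [K] := H 2 x1 x2 v; rewrite !subst2_id inV_card2 // er => ->.
  by ring.
apply: (mulfI (Lam12_neq0)); rewrite Lam_upoly br1 !E ?inV_x1 ?inV_x2 //;
  [|exact: inV_x1|exact: inV_x2].
by rewrite /Lam; ring.
Qed.

(** * [A_m] is a [D_2]-module containing 1 and the [u_s] *)

Lemma rmorph_upoly (S T : comNzRingType) (phi : {rmorphism S -> T}) r s (a b : S) (a' b' : T) :
  phi a = a' -> phi b = b' -> phi (upoly r s a b) = upoly r s a' b'.
Proof.
move=> <- <-.
have E n : phi (\sum_(i < n) (b ^+ q.-1) ^+ (n.-1 - i) * (a ^+ q.-1) ^+ i) =
    \sum_(i < n) (phi b ^+ q.-1) ^+ (n.-1 - i) * (phi a ^+ q.-1) ^+ i.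
  by rewrite rmorph_sum; apply: eq_bigr => i _; rewrite rmorphM !rmorphXn.
by rewrite /upoly; case: ifP => _; rewrite ?rmorphN rmorphM rmorphXn rmorphM !rmorphXn E.
Qed.

Lemma subst2_upoly n r s (a b : {mpoly F[n]}) :
  subst2 (upoly r s x1 x2) a b = upoly r s a b.
Proof.
exact: (rmorph_upoly (phi := comp_mpoly [tuple a; b]) r s
  (subst2_x1 a b) (subst2_x2 a b)).
Qed.

(** By [Lam_upoly] the numerator is, up to sign, a determinant with the row [y ^ [r]] repeated, so
    it is zero. *)
Lemma inA_upoly m r s : (q ^ m)%N = br r -> inA m (upoly r s x1 x2).
Proof.
move=> er; apply/inA2P; exists 0; rewrite mulr0 Ndelta3E !subst2_upoly.
move: (Lam_upoly r s y2 y3) (Lam_upoly r s y1 y3) (Lam_upoly r s y1 y2).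
move: (upoly r s y2 y3) (upoly r s y1 y3) (upoly r s y1 y2) => u23 u13 u12.
move: (Lam y2 y3) (Lam y1 y3) (Lam y1 y2) => l23 l13 l12.
rewrite er (mulrC u23) (mulrC u13) (mulrC u12) => -> -> ->.
move: (y1 ^+ br r) (y2 ^+ br r) (y3 ^+ br r) (y1 ^+ br s) (y2 ^+ br s) (y3 ^+ br s).
by move=> c0 c1 c2 c3 c4 c5; ring.
Qed.

Lemma subst2_cross n (a b : {mpoly F[n]}) d e f :
  d * Lam x1 x2 = x1 ^+ e * x2 ^+ f - x2 ^+ e * x1 ^+ f ->
  subst2 d a b * Lam a b = a ^+ e * b ^+ f - b ^+ e * a ^+ f.
Proof.
move/(congr1 (fun g => subst2 g a b)).
by rewrite subst2M subst2_Lam subst2B !subst2M !subst2X subst2_x1 subst2_x2.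
Qed.

Lemma subst2_Q0_Lam n (a b : {mpoly F[n]}) :
  subst2 Q0 a b * Lam a b = a ^+ q * b ^+ (q ^ 2) - b ^+ q * a ^+ (q ^ 2).
Proof. exact: subst2_cross (Q0_Lam). Qed.

Lemma subst2_Q1_Lam n (a b : {mpoly F[n]}) :
  subst2 Q1 a b * Lam a b = a * b ^+ (q ^ 2) - b * a ^+ (q ^ 2).
Proof. exact: (@subst2_cross n a b _ 1 _ (Q1_Lam)). Qed.

(** Capital letters stand for [q]-th powers, and [A2], [B2], [C2] for [q ^ 2]-th powers; [q0], [q1]
    are the values of the Dickson invariants. *)
Lemma moore_expand (S : comNzRingType) (a b c A B C A2 B2 C2 l q1 q0 : S) :
  l = a * B - b * A ->
  q0 * l = A * B2 - B * A2 -> q1 * l = a * B2 - b * A2 ->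
  A2 * (1 * (b * C - c * B)) - B2 * (1 * (a * C - c * A)) + C2 * (1 * l) =
  l * (C2 - q1 * C + q0 * c).
Proof.
move=> El E0 E1; transitivity (l * C2 - (q1 * l) * C + (q0 * l) * c); last by ring.
by rewrite E0 E1; ring.
Qed.

Lemma Lmoore3_factor : Lmoore F 2 3 = Lam y1 y2 *
  (y3 ^+ (q ^ 2) - subst2 Q1 y1 y2 * y3 ^+ q + subst2 Q0 y1 y2 * y3).
Proof.
rewrite Lmoore3E.
exact: (moore_expand _ _ _ (erefl (Lam y1 y2)) (subst2_Q0_Lam y1 y2) (subst2_Q1_Lam y1 y2)).
Qed.

(** Each [y ^ (q ^ m)] is [A y ^ q + B y], exactly for [y1, y2] and up to [P(y3) K] for [y3]. The
    linear part gives a determinant with dependent rows, and [Lam y1 y2 * P(y3) * K] remains. *)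
Lemma inA_1 m : inA m (1 : {mpoly F[2]}).
Proof.
apply/inA2P; have [A [B [_ [_ [_ [_ [_ H]]]]]]] := card_reduce m.
have [K EK] := H 3 y1 y2 y3; exists K.
have E v : inV v -> v ^+ (q ^ m) = A * v ^+ q + B * v.
  by move=> Vv; have [K' ->] := H 2 x1 x2 v; rewrite !subst2_id inV_card2 //; ring.
have := congr1 (fun f => subst2 f y1 y2) (E _ (inV_x1)).
have := congr1 (fun f => subst2 f y1 y2) (E _ (inV_x2)).
rewrite !subst2D !(subst2M A) !(subst2M B) !subst2X !subst2_x1 !subst2_x2 => E2 E1.
rewrite Ndelta3E !subst2_1 E1 E2 EK Lmoore3_factor /Lam; ring.
Qed.

Lemma inA_D m (f g : {mpoly F[2]}) : inA m f -> inA m g -> inA m (f + g).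
Proof.
move=> /inA2P [p E] /inA2P [p' E']; apply/inA2P; exists (p + p').
rewrite mulrDr -E -E' !Ndelta3E (subst2D f g y2 y3) (subst2D f g y1 y3) (subst2D f g y1 y2).
have lin (S : comNzRingType) (a b c u v w x y z x' y' z' : S) :
    a * ((x + x') * u) - b * ((y + y') * v) + c * ((z + z') * w) =
    (a * (x * u) - b * (y * v) + c * (z * w)) +
    (a * (x' * u) - b * (y' * v) + c * (z' * w)) by ring.
exact: lin.
Qed.

Lemma inA_Z m c (f : {mpoly F[2]}) : inA m f -> inA m (c%:MP * f).
Proof.
move=> /inA2P [p E]; apply/inA2P; exists (c%:MP * p).
have Z n (a b : {mpoly F[n]}) : subst2 (c%:MP * f) a b = c%:MP * subst2 f a b.
  by rewrite subst2M subst2C.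
rewrite mulrCA -E !Ndelta3E (Z _ y2 y3) (Z _ y1 y3) (Z _ y1 y2).
have lin (S : comNzRingType) (a b d u v w x y z k : S) :
    a * (k * x * u) - b * (k * y * v) + d * (k * z * w) =
    k * (a * (x * u) - b * (y * v) + d * (z * w)) by ring.
exact: lin.
Qed.

(** This controls the error term in [inA_MQ]. On a monomial, the [y3] part factors out and
    [Lam_upoly] applies to what is left. *)
Lemma toric_cross r e (f : {mpoly F[2]}) : toric f -> exists p,
  y1 ^+ br r * y2 ^+ br e * subst2 f y2 y3 - y2 ^+ br r * y1 ^+ br e * subst2 f y1 y3
  = Lam y1 y2 * p.
Proof.
move: f; apply: toric_ind => [|f g [p Ep] [p' Ep']|c i j].
- exists 0; rewrite (subst2_0 y2 y3) (subst2_0 y1 y3).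
  have lin (S : comNzRingType) (a b c : S) : a * 0 - b * 0 = c * 0 by ring.
  exact: lin.
- exists (p + p'); rewrite mulrDr -Ep -Ep' (subst2D f g y2 y3) (subst2D f g y1 y3).
  have lin (S : comNzRingType) (a b u v u' v' : S) :
      a * (u + u') - b * (v + v') = a * u - b * v + (a * u' - b * v') by ring.
  exact: lin.
exists (- (c%:MP * (y3 ^+ q.-1) ^+ j * upoly r (e + i) y1 y2)).
have M (a b : {mpoly F[3]}) : subst2 (c%:MP * ((x1 ^+ q.-1) ^+ i * (x2 ^+ q.-1) ^+ j)) a b =
    c%:MP * ((a ^+ q.-1) ^+ i * (b ^+ q.-1) ^+ j).
  by rewrite subst2M subst2C subst2M !subst2X subst2_x1 subst2_x2.
have brD (a : {mpoly F[3]}) : a ^+ br (e + i) = a ^+ br e * (a ^+ q.-1) ^+ i.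
  by rewrite !exprbr exprD mulrA.
have lin (S : comNzRingType) (a b a' b' u v w k l p : S) :
    l * p = b * (a' * u) - a * (b' * v) ->
    a * b' * (k * (v * w)) - b * a' * (k * (u * w)) = l * - (k * w * p).
  by move=> E; transitivity (- (l * p * k * w)); [rewrite E|]; ring.
rewrite (M y2 y3) (M y1 y3); apply: lin; rewrite -!brD; exact: Lam_upoly.
Qed.

Lemma subst2_card2 n (a b : {mpoly F[n]}) v : inV v ->
  subst2 v a b ^+ (q ^ 2) = subst2 Q1 a b * subst2 v a b ^+ q - subst2 Q0 a b * subst2 v a b.
Proof.
move/inV_card2/(congr1 (fun f => subst2 f a b)).
by rewrite subst2X subst2B !subst2M subst2X.
Qed.

(** Modulo [P(y3)], replacing the pair [y1, y2] by [a, y3] does not change a Dickson invariant, once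
    multiplied by [Lam a y3]. The exponent [br (i == 0%N)] is [q] for [Q0] and 1 for [Q1]. *)
Lemma Lam_Q_congr i (v : {mpoly F[2]}) : (i < 2)%N -> inV v ->
  let a := subst2 v y1 y2 in
  Lam a y3 * subst2 (Q F 2 i) a y3 = subst2 (Q F 2 i) y1 y2 * Lam a y3 + a ^+ br (i == 0%N) *
    (y3 ^+ (q ^ 2) - subst2 Q1 y1 y2 * y3 ^+ q + subst2 Q0 y1 y2 * y3).
Proof.
move=> lti /(subst2_card2 y1 y2) /=; set a := subst2 v y1 y2 => Ea.
have lin0 (S : comNzRingType) (x c A C A2 C2 l k q1 q0 : S) : l = x * C - c * A ->
    A2 = q1 * A - q0 * x -> k * l = A * C2 - C * A2 ->
    l * k = q0 * l + A * (C2 - q1 * C + q0 * c).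
  by move=> -> ->; rewrite mulrC => ->; ring.
have lin1 (S : comNzRingType) (x c A C A2 C2 l k q1 q0 : S) : l = x * C - c * A ->
    A2 = q1 * A - q0 * x -> k * l = x * C2 - c * A2 ->
    l * k = q1 * l + x * (C2 - q1 * C + q0 * c).
  by move=> -> ->; rewrite mulrC => ->; ring.
case: i lti => [|[|//]] _; rewrite /= ?br1 ?br0.
  exact: (lin0 _ _ _ _ _ _ _ _ _ _ _ (erefl (Lam a y3)) Ea (subst2_Q0_Lam a y3)).
exact: (lin1 _ _ _ _ _ _ _ _ _ _ _ (erefl (Lam a y3)) Ea (subst2_Q1_Lam a y3)).
Qed.

(** By [Lam_Q_congr] the numerator for [Q_i f] is [Q_i(y1, y2)] times that for [f], plus [P(y3)]
    times an error that [toric_cross] shows divisible by [Lam y1 y2]. *)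
Lemma inA_MQ m i (f : {mpoly F[2]}) : (i < 2)%N -> inA m f -> inA m (Q F 2 i * f).
Proof.
move=> lti Af; have tf := inA_toric Af; move: Af => /inA2P [p E]; apply/inA2P.
have [r er] := card_brE m.
have R1 := Lam_Q_congr lti (inV_x1); have R2 := Lam_Q_congr lti (inV_x2).
rewrite subst2_x1 in R1; rewrite subst2_x2 in R2.
have [p' E'] := toric_cross r (i == 0%N) tf.
exists (subst2 (Q F 2 i) y1 y2 * p + p').
rewrite Ndelta3E Lmoore3_factor er in E; rewrite Ndelta3E Lmoore3_factor er.
rewrite (subst2M (Q F 2 i) f y2 y3) (subst2M (Q F 2 i) f y1 y3) (subst2M (Q F 2 i) f y1 y2).
have lin (S : comNzRingType) (a b c e1 e2 f23 f13 f12 l23 l13 l12 k23 k13 k P t t' : S) :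
    l13 * k13 = k * l13 + e1 * P -> l23 * k23 = k * l23 + e2 * P ->
    a * (f23 * l23) - b * (f13 * l13) + c * (f12 * l12) = l12 * P * t ->
    a * e2 * f23 - b * e1 * f13 = l12 * t' ->
    a * (k23 * f23 * l23) - b * (k13 * f13 * l13) + c * (k * f12 * l12) =
    l12 * P * (k * t + t').
  move=> H1 H2 H3 H4.
  transitivity (a * f23 * (l23 * k23) - b * f13 * (l13 * k13) + c * (k * f12 * l12)); first by ring.
  transitivity (k * (l12 * P * t) + P * (l12 * t')); last by ring.
  by rewrite H1 H2 -H3 -H4; ring.
exact: (lin _ _ _ _ _ _ _ _ _ _ _ _ _ _ _ _ _ _ R1 R2 E E').
Qed.

Lemma inA_MD m (d f : {mpoly F[2]}) : inD d -> inA m f -> inA m (d * f).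
Proof.
move=> Dd Af; move: d Dd; apply: inD_ind => [c|d e Ad Ae|d Ad|d Ad].
- exact: inA_Z.
- by rewrite mulrDl; apply: inA_D.
- by rewrite -mulrA; apply: inA_MQ.
- by rewrite -mulrA; apply: inA_MQ.
Qed.

(** * Independence modulo Q0 *)

Lemma q_gt0 : (0 < q)%N. Proof. by rewrite ltnW // q_gt1. Qed.

Lemma qp_gt0 : (0 < q.-1)%N. Proof. by have := q_gt1; lia. Qed.

(* Expansion in powers of x2, with coefficients in F[x1]. *)
Definition psi (f : {mpoly F[2]}) : {poly {poly F}} :=
  mmap (polyC \o polyC) (fun i : 'I_2 => if i == inord 0 then 'X%:P else 'X) f.

HB.instance Definition _ := GRing.RMorphism.copy psi
  (mmap (polyC \o polyC : F -> {poly {poly F}})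
    (fun i : 'I_2 => if i == inord 0 then 'X%:P else 'X)).

Lemma psi_x1 : psi x1 = 'X%:P.
Proof. by rewrite /psi mmapX mmap1U eqxx. Qed.

Lemma psi_x2 : psi x2 = 'X.
Proof.
rewrite /psi mmapX mmap1U ifF //; apply/eqP => /(congr1 val).
by rewrite /= !inordK.
Qed.

Lemma psi_C c : psi c%:MP = c%:P%:P.
Proof. by rewrite /psi mmapC. Qed.

Definition evp (p : {poly F}) (y : {mpoly F[2]}) := (map_poly (@mpolyC 2 F) p).[y].

Lemma evpD p r y : evp (p + r) y = evp p y + evp r y.
Proof. by rewrite /evp rmorphD hornerD. Qed.
Lemma evpC c y : evp c%:P y = c%:MP.
Proof. by rewrite /evp map_polyC hornerC. Qed.
Lemma evpMX p y : evp (p * 'X) y = evp p y * y.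
Proof. by rewrite /evp rmorphM /= map_polyX hornerMX. Qed.

Lemma psi_evp p n : psi (evp p (x1 ^+ n)) = (p \Po 'X^n)%:P.
Proof.
elim/poly_ind: p => [|p c IH]; first by rewrite -polyC0 evpC psi_C comp_polyC.
rewrite evpD evpMX evpC rmorphD rmorphM rmorphXn /= psi_x1 psi_C IH.
by rewrite comp_polyD comp_polyM comp_polyC comp_polyX !polyCD polyCM rmorphXn.
Qed.

Lemma comp_polyXn_inj (p : {poly F}) n : (0 < n)%N -> p \Po 'X^n = 0 -> p = 0.
Proof.
by move=> n0 /eqP; rewrite comp_poly_eq0 ?size_polyXn // => /eqP.
Qed.

Notation qq := (q.-1 * q)%N.

Lemma Q0_mod : exists w, Q0 = x2 ^+ q.-1 * w.
Proof.
rewrite Q0E (_ : Lam x1 x2 = x2 * (x1 * x2 ^+ q.-1 - x1 ^+ q)).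
  by rewrite exprMn; eexists.
by rewrite /Lam exprq; ring.
Qed.

Lemma Lam_mod : exists w, Lam x1 x2 = x2 * w.
Proof. by exists (x1 * x2 ^+ q.-1 - x1 ^+ q); rewrite /Lam exprq; ring. Qed.

(** As [br q.+1 = q ^ 2], this makes [Q1] an explicit geometric sum, with a single term free of
    [x2]. *)
Lemma Q1_upoly : Q1 = upoly q.+1 0 x1 x2.
Proof.
apply: (mulfI (Lam12_neq0)); rewrite Lam_upoly mulrC Q1_Lam br0 !expr1.
have := br_addq 0; rewrite add0n br0 => e; have -> : br q.+1 = (q ^ 2)%N by lia.
by ring.
Qed.

Lemma Q1_mod : exists w, Q1 = x1 ^+ qq + x2 ^+ q.-1 * w.
Proof.
rewrite Q1_upoly /upoly /= expr0 mul1r subn0 big_ord_recr /= subnn expr0 mul1r.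
exists (\sum_(i < q) (x2 ^+ q.-1) ^+ (q - i).-1 * (x1 ^+ q.-1) ^+ i).
rewrite addrC -exprM mulr_sumr; congr (_ + _); apply: eq_bigr => i _.
by rewrite mulrA -exprS prednK // subn_gt0.
Qed.

(** The same [p] gives the residue of [d] modulo [Q0] inside [D_2] and modulo [x2 ^ (q-1)] among all
    polynomials, because [Q1] reduces to [x1 ^ (q (q-1))]. *)
Lemma inD_dec d : inD d -> exists p d' w, [/\ inD d', d = evp p Q1 + Q0 * d' &
  d = evp p (x1 ^+ qq) + x2 ^+ q.-1 * w].
Proof.
(* Membership in [D_2] is carried along because [Q0 * f] takes [f] itself as its [d']. *)
move=> Dd; suff [] : inD d /\ exists p d' w, [/\ inD d', d = evp p Q1 + Q0 * d' &
  d = evp p (x1 ^+ qq) + x2 ^+ q.-1 * w] by [].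
move: d Dd; apply: inD_ind => [c|f g [Df [p [f' [w [D1 E1 H1]]]]] [Dg [r [g' [v [D2 E2 H2]]]]]
  |f [Df _]|f [Df [p [f' [w [D1 E1 H1]]]]]].
- split; first exact: inD_C.
  exists c%:P, 0, 0; split; [exact: inD_0 | |]; by rewrite evpC mulr0 addr0.
- split; first exact: inD_D.
  exists (p + r), (f' + g'), (w + v); split; first exact: inD_D.
    by rewrite evpD mulrDr addrACA -E1 -E2.
  by rewrite evpD mulrDr addrACA -H1 -H2.
- split; first by apply: inD_M => //; exact: inD_Q0.
  have [w Ew] := Q0_mod; exists 0, f, (w * f); split => //.
    by rewrite -polyC0 evpC mpolyC0 add0r.
  by rewrite -polyC0 evpC mpolyC0 add0r mulrA -Ew.
split; first by apply: inD_M => //; exact: inD_Q1.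
have [w1 Ew1] := Q1_mod; exists (p * 'X), (Q1 * f'), (w1 * f + x1 ^+ qq * w); split.
- by apply: inD_M => //; exact: inD_Q1.
- by rewrite evpMX mulrC {1}E1 mulrDl -mulrA (mulrC f').
rewrite evpMX {1}Ew1 mulrDl {1}H1.
have lin (S : comNzRingType) (a b c u v y : S) :
    a * (b + c * u) + c * v * y = b * a + c * (v * y + a * u) by ring.
exact: lin.
Qed.

(** For [Q0 r] in [D_2], the part [p] of [inD_dec] satisfies that [p(x1 ^ (q (q-1)))] is a multiple
    of [x2 ^ (q-1)]; being free of [x2], it is zero. *)
Lemma inD_Q0_cancel n r : inD (Q0 ^+ n * r) -> inD r.
Proof.
elim: n r => [|n IH] r; first by rewrite mul1r.
rewrite exprSr -mulrA => /IH {IH} /inD_dec [p [d' [w [Dd' E1 E2]]]].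
have [w0 Ew0] := Q0_mod.
have p0 : p = 0.
  apply: (@comp_polyXn_inj _ qq); first by rewrite muln_gt0 qp_gt0 q_gt0.
  have E : evp p (x1 ^+ qq) = x2 ^+ q.-1 * (w0 * r - w).
    by rewrite mulrBr mulrA -Ew0 E2 addrK.
  have := congr1 (fun f => (psi f)`_0) E.
  by rewrite psi_evp rmorphM rmorphXn /= psi_x2 coefC eqxx coefXnM qp_gt0 => ->.
have Q00 : Q0 != 0 by rewrite Q0E expf_eq0 (negbTE (Lam12_neq0)) andbF.
by have /(mulfI Q00) -> : Q0 * r = Q0 * d' by rewrite E1 p0 -polyC0 evpC mpolyC0 add0r.
Qed.

Definition num s := x1 ^+ br s + x2 ^+ br s - (x1 + x2) ^+ br s.

(** Write [[i+2] = q (i+1) + (q-1-i)] and apply the Frobenius to the first part. The cruder form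
    [x2 * w] serves for terms that already carry [x2 ^ (q-1)]. *)
Lemma num_mod i : (i < q.-1)%N -> exists v w,
  num i.+2 = x1 ^+ (q * i.+1) * (x1 ^+ (q.-1 - i) - (x1 + x2) ^+ (q.-1 - i)) + x2 ^+ q * v
  /\ num i.+2 = x2 * w.
Proof.
move=> lti.
have e1 : br i.+2 = (q * i.+1 + (q.-1 - i))%N.
  by move: lti; rewrite /br; have := q_gt1; case: (q) => // n _ /= lti; nia.
have e2 : br i.+2 = (q + (br i.+2 - q))%N by rewrite subnKC // e1 mulnS -addnA leq_addr.
have [u1 Eu1] := expr_add_mod (x1 ^+ q) (x2 ^+ q) i.+1.
have [u2 Eu2] := expr_add_mod x1 x2 (q.-1 - i).
have fD : (x1 + x2) ^+ q = x1 ^+ q + x2 ^+ q by have := exprD_card 1 x1 x2; rewrite expn1.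
have E : num i.+2 = x1 ^+ (q * i.+1) * (x1 ^+ (q.-1 - i) - (x1 + x2) ^+ (q.-1 - i)) +
    x2 ^+ q * (x2 ^+ (br i.+2 - q) - u1 * (x1 + x2) ^+ (q.-1 - i)).
  rewrite /num {2}e2 e1 !exprD !(exprM _ q) fD Eu1.
  move: (x1 ^+ q ^+ i.+1) (x2 ^+ q) (x1 ^+ (q.-1 - i)) ((x1 + x2) ^+ (q.-1 - i)).
  by move=> a b c d; ring.
exists (x2 ^+ (br i.+2 - q) - u1 * (x1 + x2) ^+ (q.-1 - i)).
exists (- (x1 ^+ (q * i.+1) * u2) +
  x2 ^+ q.-1 * (x2 ^+ (br i.+2 - q) - u1 * (x1 + x2) ^+ (q.-1 - i))).
split=> //; rewrite E {1}Eu2 exprq.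
move: (_ - _ * _) (x1 ^+ (q * i.+1)) (x2 ^+ q.-1) (x1 ^+ (q.-1 - i)) => a b c d; ring.
Qed.

(** Modulo [x2 ^ q] the right side vanishes and each [d i] may be replaced by its residue [p i] at
    [x1 ^ (q (q-1))]; [binomial_diff_free] then forces every [p i] to be zero. *)
Lemma descent_step e (d : 'I_q.-1 -> {mpoly F[2]}) g : (forall i, inD (d i)) ->
  x1 ^+ e * \sum_(i < q.-1) d i * num i.+2 = Q0 * (Lam x1 x2 * g) ->
  exists d' : 'I_q.-1 -> {mpoly F[2]}, forall i, inD (d' i) /\ d i = Q0 * d' i.
Proof.
move=> Dd E.
have /fin_all_exists [p /fin_all_exists [d' /fin_all_exists [w H]]] :
  forall i, exists p d' w, [/\ inD d', d i = evp p Q1 + Q0 * d' &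
    d i = evp p (x1 ^+ qq) + x2 ^+ q.-1 * w].
  by move=> i; apply: inD_dec.
have /fin_all_exists [v /fin_all_exists [u N]] := fun i : 'I_q.-1 => num_mod (ltn_ord i).
have [w0 Ew0] := Q0_mod; have [l El] := Lam_mod.
suff p0 k : p k = 0.
  exists d' => i; have [Dd' -> _] := H i; split=> //.
  by rewrite p0 -polyC0 evpC mpolyC0 add0r.
pose B i := x1 ^+ (q.-1 - i) - (x1 + x2) ^+ (q.-1 - i).
have X2 : x2 ^+ q = x2 ^+ q.-1 * x2 by rewrite mulrC -exprq.
have EE : \sum_(i < q.-1) (x1 ^+ e * evp (p i) (x1 ^+ qq) * x1 ^+ (q * i.+1)) * B i =
    x2 ^+ q * (w0 * (l * g) - \sum_(i < q.-1) x1 ^+ e * (evp (p i) (x1 ^+ qq) * v i + w i * u i)).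
  rewrite mulrBr (_ : x2 ^+ q * (w0 * (l * g)) = Q0 * (Lam x1 x2 * g)); last first.
    by rewrite X2 El Ew0; move: (x2 ^+ _) => a; ring.
  rewrite -E !mulr_sumr -sumrB; apply: eq_bigr => i _.
  have [_ _ Ei] := H i; have [N1 N2] := N i.
  rewrite Ei mulrDl mulrDr -[x2 ^+ q.-1 * _ * _]mulrA {1}N1 {1}N2 X2 -/(B i).
  by move: (x2 ^+ q.-1) (x1 ^+ e) (evp _ _) (B i) (x1 ^+ _) => a b c b' c'; ring.
have := congr1 psi EE; rewrite rmorph_sum rmorphM rmorphXn /= psi_x2 => EP.
have : x1 ^+ e != 0 by rewrite expf_neq0 // x_neq0.
(* Here [t] is [x1], the variable of the outer polynomials is [x2], and the [a i] are the
   coefficients in [F[x1]]. *)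
pose a (i : 'I_q.-1) := 'X^e * (p i \Po 'X^qq) * 'X^(q * i.+1) : {poly F}.
have a0 : a k = 0.
  apply: (@binomial_diff_free _ q.-1 'X a (psi (w0 * (l * g) -
    \sum_(i < q.-1) x1 ^+ e * (evp (p i) (x1 ^+ qq) * v i + w i * u i)))).
  rewrite prednK; last by rewrite ltnW // q_gt1.
  rewrite -EP; apply: eq_bigr => j _.
  by rewrite !rmorphM rmorphB !rmorphXn rmorphD /= psi_x1 psi_x2 psi_evp.
move=> _; apply: (@comp_polyXn_inj _ qq); first by rewrite muln_gt0 qp_gt0 q_gt0.
move/eqP: a0; rewrite /a !mulf_eq0 !expf_eq0 polyX_eq0 !andbF orbF /= => /eqP //.
Qed.

Lemma Q0_neq0 : Q0 != 0.
Proof. by rewrite Q0E expf_eq0 (negbTE (Lam12_neq0)) andbF. Qed.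

Lemma descent n e (d : 'I_q.-1 -> {mpoly F[2]}) g : (forall i, inD (d i)) ->
  x1 ^+ e * \sum_(i < q.-1) d i * num i.+2 = Q0 ^+ n * (Lam x1 x2 * g) ->
  exists d' : 'I_q.-1 -> {mpoly F[2]}, forall i, inD (d' i) /\ d i = Q0 ^+ n * d' i.
Proof.
elim: n d => [|n IH] d Dd E; first by exists d => i; rewrite mul1r.
have [|d1 H1] := @descent_step e d (Q0 ^+ n * g) Dd.
  by rewrite E exprS; move: (Q0 ^+ n) (Lam _ _) => a b; rewrite -!mulrA (mulrCA b).
have [i|| d' H'] := IH d1; first by case: (H1 i).
  apply: (mulfI Q0_neq0); rewrite [RHS]mulrA -exprS -E mulrCA mulr_sumr; congr (_ * _).
  by apply: eq_bigr => i _; rewrite mulrA; case: (H1 i) => _ <-.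
exists d' => i; have [D' E'] := H' i; split=> //.
by have [_ ->] := H1 i; rewrite E' mulrA -exprS.
Qed.

(** A zero sum lets [descent] divide by every power of [Q0], so [x2 ^ n] divides [d i] for all [n].
    Taking [n] to be one more than the degree of [d i] is contradictory unless [d i = 0]. *)
Lemma num_free (d : 'I_q.-1 -> {mpoly F[2]}) : (forall i, inD (d i)) ->
  \sum_(i < q.-1) d i * num i.+2 = 0 -> forall i, d i = 0.
Proof.
move=> Dd E i; set n := mmeasure mdeg (d i).
have [|d' /(_ i) [_ Ei]] := @descent n 0 d 0 Dd; first by rewrite E !mulr0.
apply/eqP; apply: contraT => di0.
have [w Ew] := Q0_mod.
have q1 := qp_gt0.
have E2 : d i = x2 ^+ n * (x2 ^+ (q.-1 * n - n) * w ^+ n * d' i).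
  rewrite Ei Ew exprMn -exprM !mulrA -exprD subnKC // leq_pmull //.
set r := (X in x2 ^+ n * X) in E2.
have r0 : r != 0 by apply: contraNneq di0 => r0; rewrite E2 r0 mulr0.
have := congr1 (mmeasure mdeg) E2; rewrite -/n msizeM // ?expf_neq0 ?x_neq0 //.
rewrite /xv mpolyXn msizeX mdegMn mdeg1 mul1n.
have : (0 < mmeasure mdeg r)%N by rewrite lt0n msize_poly_eq0.
move: (mmeasure mdeg r) (n) => u k u0 ek; exfalso; lia.
Qed.

(** * The two bases *)

Notation T f := (subst2 f (x1 + x2) x2).

Lemma Lam_T : Lam (x1 + x2) x2 = Lam x1 x2.
Proof. by rewrite LamDl Lamxx addr0. Qed.

Lemma upoly_T m r s : (q ^ m)%N = br r ->
  Lam x1 x2 * (upoly r s x1 x2 - T (upoly r s x1 x2)) = x2 ^+ (q ^ m) * num s.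
Proof.
move=> er; have E1 := Lam_upoly r s x1 x2; have E2 := Lam_upoly r s (x1 + x2) x2.
rewrite Lam_T -er exprD_card in E2; rewrite -er in E1; rewrite subst2_upoly.
have lin (S : comNzRingType) (a b c d e l u v : S) :
    l * u = b * c - a * d -> l * v = b * e - (a + b) * d ->
    l * (u - v) = b * (c + d - e).
  by move=> H1 H2; rewrite mulrBr H1 H2; ring.
exact: lin E1 E2.
Qed.

(** This is [inA_V] at [v = x1 + x2], combined with the symmetry of [f]. The factor [x1 ^ (q ^ m)]
    is the reason for [x1 ^+ e] in [descent]. *)
Lemma inA_T m (f : {mpoly F[2]}) : inA m f ->
  exists g, x1 ^+ (q ^ m) * (f - T f) = x2 ^+ (q ^ m) * g.
Proof.
move=> Af; have Vv : inV (x1 + x2) by exists 1, 1; rewrite mpolyC1 !mul1r.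
have := inA_V Af Vv; set g := subst2 f x1 _ => E; exists (g - f); move: E.
have -> : subst2 f x2 (x1 + x2) = T f.
  rewrite -{2}(inA_sym Af).
  by rewrite [RHS](subst2_subst2 f x2 x1 [tuple x1 + x2; x2]) !xv_comp.
rewrite !LamDr !Lamxx (LamC x2 x1) add0r addr0 exprD_card.
have lin (S : comNzRingType) (a b u v w l : S) :
    a * (u * - l) - b * (v * l) + (a + b) * (w * l) = l * (a * (w - u) - b * (v - w)).
  by ring.
rewrite lin => /eqP; rewrite mulf_eq0 (negbTE (Lam12_neq0)) /= subr_eq0.
by move/eqP.
Qed.

Lemma comb_T m r d0 (d : 'I_q.-1 -> {mpoly F[2]}) : (q ^ m)%N = br r ->
  inD d0 -> (forall i, inD (d i)) ->
  let f := d0 + \sum_(i < q.-1) d i * upoly r i.+2 x1 x2 in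
  Lam x1 x2 * (f - T f) = x2 ^+ (q ^ m) * \sum_(i < q.-1) d i * num i.+2.
Proof.
move=> er D0 Dd /=; rewrite subst2D subst2_sum (inD_T D0) opprD addrACA subrr add0r.
rewrite -sumrB !mulr_sumr; apply: eq_bigr => i _.
rewrite subst2M (inD_T (Dd i)) -mulrBr mulrCA (upoly_T i.+2 er); exact: mulrCA.
Qed.

Lemma inA_decomp m r (f : {mpoly F[2]}) : (q ^ m)%N = br r -> inA m f ->
  exists d0 (d : 'I_q.-1 -> {mpoly F[2]}), [/\ inD d0, forall i, inD (d i) &
    f = d0 + \sum_(i < q.-1) d i * upoly r i.+2 x1 x2].
Proof.
move=> er Af; have [k [d [Dd E]]] := inA_reduce er Af.
pose d0 := d 0%N * upoly r 0 x1 x2 + d 1%N * upoly r 1 x1 x2.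
have D0 : inD d0.
  by apply: inD_D; apply: inD_M => //; [exact: upoly0_inD er|exact: upoly1_inD er].
have {}E : Q0 ^+ k * f = d0 + \sum_(i < q.-1) d i.+2 * upoly r i.+2 x1 x2.
  have split2 n (G : nat -> {mpoly F[2]}) :
      \sum_(t < n.+2) G t = G 0%N + G 1%N + \sum_(i < n) G i.+2.
    by rewrite !big_ord_recl addrA.
  rewrite E -(split2 _ (fun t => d t * upoly r t x1 x2)).
  by rewrite prednK // ltnW // q_gt1.
have TQ : T (Q0 ^+ k) = Q0 ^+ k by apply: inD_T; apply: inD_X; exact: inD_Q0.
have [g Eg] := inA_T Af.
have := comb_T er D0 (fun i : 'I_q.-1 => Dd i.+2); rewrite /= -E subst2M TQ => E2.
(* Applying [1 - T] to [Q0 ^ k f] removes [d0]; cancelling [x2 ^ (q ^ m)] leaves the hypothesis of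
   [descent]. *)
have E3 : x1 ^+ (q ^ m) * \sum_(i < q.-1) d i.+2 * num i.+2 = Q0 ^+ k * (Lam x1 x2 * g).
  apply: (mulfI (_ : x2 ^+ (q ^ m) != 0)); first by rewrite expf_neq0 // x_neq0.
  rewrite [LHS]mulrCA -E2.
  have lin (S : comNzRingType) (a b c u v w l t : S) : a * (u - v) = b * w ->
    a * (l * (t * u - t * v)) = b * (t * (l * w)).
    by move=> H; transitivity (l * t * (a * (u - v))); [|rewrite H]; ring.
  exact: lin.
have [d' H'] := descent (fun i : 'I_q.-1 => Dd i.+2) E3.
(* The new constant term times [Q0 ^ k] is [d0], so [inD_Q0_cancel] puts it in [D_2]. *)
exists (f - \sum_(i < q.-1) d' i * upoly r i.+2 x1 x2), d'; split.
- apply: (@inD_Q0_cancel k); rewrite mulrBr E mulr_sumr.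
  rewrite (eq_bigr (fun i : 'I__ => Q0 ^+ k * (d' i * upoly r i.+2 x1 x2))) ?addrK //.
  by move=> i _; have [_ ->] := H' i; rewrite mulrA.
- by move=> i; case: (H' i).
by rewrite subrK.
Qed.

Lemma inA_comb m r d0 (d : 'I_q.-1 -> {mpoly F[2]}) : (q ^ m)%N = br r ->
  inD d0 -> (forall i, inD (d i)) ->
  inA m (d0 + \sum_(i < q.-1) d i * upoly r i.+2 x1 x2).
Proof.
move=> er D0 Dd; apply: inA_D.
  by rewrite -[d0]mulr1; apply: inA_MD => //; apply: inA_1.
apply: (big_ind (@inA F 2 m)) => [||i _].
- by have := inA_Z 0 (inA_1 m); rewrite mpolyC0 mul0r.
- by move=> f g; apply: inA_D.
by apply: inA_MD => //; apply: inA_upoly.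
Qed.

Lemma comb_free m r d0 (d : 'I_q.-1 -> {mpoly F[2]}) : (q ^ m)%N = br r ->
  inD d0 -> (forall i, inD (d i)) ->
  d0 + \sum_(i < q.-1) d i * upoly r i.+2 x1 x2 = 0 -> d0 = 0 /\ forall i, d i = 0.
Proof.
move=> er D0 Dd E; have := comb_T er D0 Dd; rewrite /= E subst2_0 subrr mulr0.
move/esym/eqP; rewrite mulf_eq0 expf_eq0 (negbTE (x_neq0 1 1)) andbF /= => /eqP.
move/(num_free Dd) => d0'; split=> //; rewrite -[RHS]E big1 ?addr0 // => i _.
by rewrite d0' mul0r.
Qed.

(** * Passage to the fraction field and to sequences of basis elements *)

Notation K := {fraction {mpoly F[2]}}.

Lemma free_basis_mkseq (M : K -> Prop) (B : nat -> K) n :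
  (forall g, M g <-> exists d : 'I_n -> {mpoly F[2]}, (forall i, inD (d i)) /\
    g = \sum_(i < n) toF (d i) * B i) ->
  (forall d : 'I_n -> {mpoly F[2]}, (forall i, inD (d i)) ->
    \sum_(i < n) toF (d i) * B i = 0 -> forall i, d i = 0) ->
  free_basis (@D2K F) M (mkseq B n).
Proof.
move=> HM HF.
have toD (c : seq K) : size c = size (mkseq B n) ->
    (forall i, (i < size c)%N -> D2K c`_i) ->
    exists d : 'I_n -> {mpoly F[2]}, (forall i, inD (d i)) /\ forall i : 'I_n, c`_i = toF (d i).
  rewrite size_mkseq => sc Dc.
  have /fin_all_exists [d H] : forall i : 'I_n, exists d, inD d /\ c`_i = toF d.
    by move=> i; apply: Dc; rewrite sc.
  by exists d; split=> i; case: (H i).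
have sumE (c : seq K) (d : 'I_n -> {mpoly F[2]}) : (forall i : 'I_n, c`_i = toF (d i)) ->
    \sum_(i < size (mkseq B n)) c`_i * (mkseq B n)`_i = \sum_(i < n) toF (d i) * B i.
  move=> H; rewrite size_mkseq; apply: eq_bigr => i _.
  by rewrite H nth_mkseq.
split=> [g|c sc Dc].
  split=> [/HM [d [Dd ->]]|[c [sc Dc ->]]].
    (* The family is extended by 0 outside its index range. *)
    pose dn j := oapp (fun i : 'I_n => toF (d i)) 0 (insub j).
    have dnE (i : 'I_n) : (mkseq dn n)`_i = toF (d i) by rewrite nth_mkseq // /dn valK.
    exists (mkseq dn n); split; first by rewrite !size_mkseq.
      by rewrite size_mkseq => i lti; rewrite (dnE (Ordinal lti)); exists (d (Ordinal lti)).
    by rewrite (sumE _ d).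
  by have [d [Dd Ed]] := toD c sc Dc; apply/HM; exists d; split=> //; apply: sumE.
have [d [Dd Ed]] := toD c sc Dc; rewrite (sumE _ d) // => E i lti.
have lti' : (i < n)%N by rewrite sc size_mkseq in lti.
by rewrite (Ed (Ordinal lti')) (HF d) // /toF tofrac0.
Qed.

Lemma toF_sum n (f : 'I_n -> {mpoly F[2]}) : toF (\sum_(i < n) f i) = \sum_(i < n) toF (f i).
Proof. exact: rmorph_sum. Qed.

Lemma basisAE m r : (q ^ m)%N = br r -> basisA F m =
  mkseq (fun i => if i is j.+1 then toF (upoly r j.+2 x1 x2) else 1) q.-1.+1.
Proof.
move=> er; rewrite /basisA /mkseq /=; congr (_ :: _).
have I k n : iota k n = [seq (k + i)%N | i <- iota 0 n] by rewrite -iotaDl addn0.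
rewrite (I 2%N) (I 1%N) -!map_comp; apply: eq_map => s /=.
exact: delta2E.
Qed.

Lemma basisME : basisM F = mkseq (fun j => toF (num j.+2) / toF (Lam x1 x2)) q.-1.
Proof.
have I k n : iota k n = [seq (k + i)%N | i <- iota 0 n] by rewrite -iotaDl addn0.
rewrite /basisM /mkseq (I 2%N) -map_comp; apply: eq_map => s /=.
by rewrite subn1.
Qed.

Lemma A_free_basis m : free_basis (@D2K F) (@A2K F m) (@basisA F m).
Proof.
have [r er] := card_brE m; rewrite (basisAE er).
have sumE (d : 'I_q.-1.+1 -> {mpoly F[2]}) :
    \sum_(i < q.-1.+1) toF (d i) * (if (i : nat) is j.+1 then toF (upoly r j.+2 x1 x2) else 1)
    = toF (d ord0 + \sum_(i < q.-1) d (lift ord0 i) * upoly r i.+2 x1 x2).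
  rewrite big_ord_recl /= mulr1 /toF tofracD; congr (_ + _).
  rewrite -/(toF _) toF_sum; apply: eq_bigr => i _.
  by rewrite /toF tofracM.
apply: free_basis_mkseq => [g|d Dd].
  split=> [[f [/(inA_decomp er) [d0 [d [D0 Dd ->]]] ->]]|[d [Dd ->]]].
    exists (fun i => oapp d d0 (unlift ord0 i)); split.
      by move=> i; case: unliftP => [j|] _ /=.
    rewrite sumE unlift_none /=; congr (toF (_ + _)).
    by apply: eq_bigr => i _; rewrite liftK.
  rewrite sumE; eexists; split; last by reflexivity.
  exact: inA_comb.
rewrite sumE => /eqP; rewrite /toF tofrac_eq0 => /eqP /(comb_free er) [//|//|d0 d1] i.
by case: (unliftP ord0 i) => [j|] ->.
Qed.

Lemma M_free_basis m : free_basis (@D2K F) (@Mset F m) (@basisM F).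
Proof.
have [r er] := card_brE m; rewrite basisME.
have L0 : toF (Lam x1 x2) != 0 by rewrite /toF tofrac_eq0 Lam12_neq0.
have X0 : toF (x2 ^+ (q ^ m)) != 0 by rewrite /toF tofrac_eq0 expf_neq0 ?x_neq0.
have sumE (d : 'I_q.-1 -> {mpoly F[2]}) :
    \sum_(i < q.-1) toF (d i) * (toF (num i.+2) / toF (Lam x1 x2)) =
    toF (\sum_(i < q.-1) d i * num i.+2) / toF (Lam x1 x2).
  rewrite toF_sum mulr_suml; apply: eq_bigr => i _.
  by rewrite mulrA /toF tofracM.
(* The quotient defining [Mset] forgets [d0] and depends on [m] no longer. *)
have MsetE d0 (d : 'I_q.-1 -> {mpoly F[2]}) : inD d0 -> (forall i, inD (d i)) ->
    let f := d0 + \sum_(i < q.-1) d i * upoly r i.+2 x1 x2 in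
    (toF f - toF (T f)) / toF (x2 ^+ (q ^ m)) =
    toF (\sum_(i < q.-1) d i * num i.+2) / toF (Lam x1 x2).
  by move=> D0 Dd f; exact: toF_div_eq X0 L0 (comb_T er D0 Dd).
apply: free_basis_mkseq => [g|d Dd].
  split=> [[f [/(inA_decomp er) [d0 [d [D0 Dd Ef]]] ->]]|[d [Dd ->]]].
    exists d; split=> //; rewrite sumE Ef; exact: MsetE.
  exists (0 + \sum_(i < q.-1) d i * upoly r i.+2 x1 x2); split.
    by apply: inA_comb => //; apply: inD_0.
  by rewrite sumE; symmetry; apply: MsetE => //; apply: inD_0.
rewrite sumE => /eqP; rewrite mulf_eq0 invr_eq0 (negbTE L0) orbF /toF tofrac_eq0.
by move=> /eqP; apply: num_free.
Qed.

End Dickson.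

Theorem mainTheorem14 (F : finFieldType) (m : nat) :
  free_basis (@D2K F) (@A2K F m) (@basisA F m) /\
  (forall m' : nat, forall g, @Mset F m g <-> @Mset F m' g) /\
  free_basis (@D2K F) (@Mset F m) (@basisM F).
Proof.
split; first exact: A_free_basis.
split; last exact: M_free_basis.
(* Both modules are the span of [basisM F], in which [m] does not occur. *)
move=> m' g; have [-> _] := M_free_basis F m; have [-> _] := M_free_basis F m'.
by [].
Qed.
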